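(* Let the profile function $f$ be the Heaviside function and let $R_d(\rho,\theta,t):=A_d(\rho,\theta)-A_d(\rho,\theta,t)$ be the difference between the limiting amplitude and the amplitude of the diffracted wave, $\rho>0$, $\theta\in\Theta$, $t\ge0$. The real and imaginary parts of $e^{-i\omega_0t}R_d$ admit the following asymptotic behavior as $t\to+\infty$: $$\mathrm{Re}\left[e^{-i\omega_0t}R_d(\rho,\theta,t)\right]=-\frac{b_1z_1(2q+1)}{4\Phi\omega_0^2}\left(\frac{\rho}{2}\right)^{2q}t^{-(2q+2)}+O\left(t^{-(4q+2)}\right),$$ $$\mathrm{Im}\left[e^{-i\omega_0t}R_d(\rho,\theta,t)\right]=-\frac{b_1z_1}{4\Phi\omega_0}\left(\frac{\rho}{2}\right)^{2q}t^{-(2q+1)}+O\left(t^{-(4q+1)}\right),$$ where $0<\rho\le\rho_0$ and the symbol $O(\cdot)$ depends only on $\rho_0$.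
   Context: Fix $\omega_0>0$, $\phi\in(0,\pi)$, $\Phi:=2\pi-\phi\in(\pi,2\pi)$, $q:=\pi/(2\Phi)$, and $\alpha$ with $\max\{\phi-\frac{\pi}{2},0\}<\alpha<\min\{\frac{\pi}{2},\phi\}$ (these parameters are fixed; ''depends only on $\rho_0$'' means the constant is independent of $\rho\in(0,\rho_0]$ and $\theta\in\Theta$). Put $\theta_1:=2\phi-\alpha$, $\theta_2:=2\pi-\alpha$, $\Theta:=[\phi,2\pi]\setminus\{\theta_1,\theta_2\}$, and $$H_N(\beta):=\coth\left[q\left(\beta+\tfrac{i\pi}{2}-i\alpha\right)\right]+\coth\left[q\left(\beta-\tfrac{3i\pi}{2}+i\alpha\right)\right],\qquad Z_N(\beta):=H_N\left(\beta-\tfrac{5i\pi}{2}\right)-H_N\left(\beta-\tfrac{i\pi}{2}\right).$$ Then $$A_d(\rho,\theta):=\frac{i}{4\Phi}\int_{\mathbb{R}}e^{i\omega_0\rho\cosh\beta}Z_N(\beta+i\theta)\,d\beta,\qquad A_d(\rho,\theta,t):=\frac{i}{4\Phi}\int_{\mathbb{R}}e^{i\omega_0\rho\cosh\beta}f(t-\rho\cosh\beta)Z_N(\beta+i\theta)\,d\beta,$$ $$b_1:=4\sin\left(\frac{\pi^2}{\Phi}\right),\qquad z_1=z_1(\theta,\alpha):=4\cos\left[\frac{\pi}{\Phi}(2\pi-\theta)\right]\cos\left[\frac{\pi}{\Phi}(\pi-\alpha)\right].$$ *)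

(* Defs.v *)
From Stdlib Require Import Reals.
From Coquelicot Require Import Coquelicot.
Open Scope R_scope.

Definition Cexp (z : C) : C :=
  (exp (Re z) * cos (Im z), exp (Re z) * sin (Im z)).

Definition Ccosh (z : C) : C := ((Cexp z + Cexp (- z)) / RtoC 2)%C.
Definition Csinh (z : C) : C := ((Cexp z - Cexp (- z)) / RtoC 2)%C.

(* At the poles (zeros of [Csinh]) the value is the junk value of [Cinv]. *)
Definition Ccoth (z : C) : C := (Ccosh z / Csinh z)%C.

(* Coquelicot has no [CompleteNormedModule] instance on [C], so the improper
   integral is taken componentwise. *)
Definition CRInt_line (g : R -> C) : C :=
  (RInt_gen (fun x => Re (g x)) (Rbar_locally m_infty) (Rbar_locally p_infty),
   RInt_gen (fun x => Im (g x)) (Rbar_locally m_infty) (Rbar_locally p_infty)).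

Definition PHI (phi : R) : R := 2 * PI - phi.
Definition q (phi : R) : R := PI / (2 * PHI phi).

Definition theta1 (phi alpha : R) : R := 2 * phi - alpha.
Definition theta2 (alpha : R) : R := 2 * PI - alpha.

Definition in_Theta (phi alpha theta : R) : Prop :=
  phi <= theta <= 2 * PI /\ theta <> theta1 phi alpha /\ theta <> theta2 alpha.

Definition H_N (phi alpha : R) (beta : C) : C :=
  (Ccoth (RtoC (q phi)
          * (beta + Ci * RtoC (PI / 2) - Ci * RtoC alpha))
   + Ccoth (RtoC (q phi)
            * (beta - Ci * RtoC (3 * PI / 2) + Ci * RtoC alpha)))%C.

Definition Z_N (phi alpha : R) (beta : C) : C :=
  (H_N phi alpha (beta - Ci * RtoC (5 * PI / 2))
   - H_N phi alpha (beta - Ci * RtoC (PI / 2)))%C.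

(* The value at 0 is immaterial: it affects at most two points of the
   integration line in [A_d_t]. *)
Definition heaviside (s : R) : R := if Rlt_dec s 0 then 0 else 1.

Definition A_d (omega0 phi alpha rho theta : R) : C :=
  (Ci / RtoC (4 * PHI phi)
   * CRInt_line (fun beta : R =>
       Cexp (Ci * RtoC (omega0 * rho * cosh beta))
       * Z_N phi alpha (RtoC beta + Ci * RtoC theta)))%C.

Definition A_d_t (omega0 phi alpha : R) (f : R -> R) (rho theta t : R) : C :=
  (Ci / RtoC (4 * PHI phi)
   * CRInt_line (fun beta : R =>
       Cexp (Ci * RtoC (omega0 * rho * cosh beta))
       * RtoC (f (t - rho * cosh beta)%R)
       * Z_N phi alpha (RtoC beta + Ci * RtoC theta)))%C.

Definition R_d (omega0 phi alpha : R) (f : R -> R) (rho theta t : R) : C :=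
  (A_d omega0 phi alpha rho theta - A_d_t omega0 phi alpha f rho theta t)%C.

Definition b1 (phi : R) : R := 4 * sin (PI ^ 2 / PHI phi).

Definition z1 (phi alpha theta : R) : R :=
  4 * cos (PI / PHI phi * (2 * PI - theta)) * cos (PI / PHI phi * (PI - alpha)).

(* Main.v *)
(** Writing the coth's in real and imaginary parts shows that, on the contour, the real part of
    [Z_N] is odd and its imaginary part even in [beta].  With [t = rho * cosh B] the cut-off is
    [|beta| <= B], so [exp (- i omega0 t) R_d = - (C + i S) / (4 Phi)], where [C] and [S] are the
    integrals over [[B, oo)] of [h = 2 Im Z_N] against [cos X] and [sin X],
    [X = omega0 (rho cosh beta - t)].  Since [h] equals [b1 z1 exp (- 2 q beta)] up to
    [O (exp (- 4 q beta))], also after differentiation, integrating by parts in the variable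
    [s = rho cosh beta], i.e. with the operator [(rho sinh beta)^-1 d/dbeta], two times for [S]
    and three times for [C], gives the leading terms as boundary terms at [B] ([X = 0] there)
    and remainders of the stated order because [2 q < 1].  All constants are uniform in [theta]
    because the poles approach the real axis only at [beta = 0]. *)
Require Import Defs.
From Stdlib Require Import Reals Lra Lia FunctionalExtensionality.
From Coquelicot Require Import Coquelicot.
Open Scope R_scope.

(** Each integration by parts in [s] gains a factor of order [exp (- beta) / rho]. The cosine
    integral takes one more than the sine integral because [sin X] vanishes at [B], so that its
    first boundary term is lost. In both cases the last integration by parts is there because the
    remainder before it has the same size as the leading term. Two uniformities shape the estimates.
    As [rho] tends to 0 the factors [rho ^ - m] blow up, but [t = rho * cosh B] gives
    [exp (- B) <= rho / t], hence [exp (- b B) / rho ^ m <= rho ^ (b - m) t ^ - b], which is bounded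
    in [rho <= rho0] as long as [b >= m]. As [theta] tends to an excluded angle the kernel blows up
    near [beta = 0]; its quantitative estimates are therefore made on [beta > 1], and
    [t > rho0 * cosh 1] ensures [B > 1]. The region near 0 enters only through continuity and
    convergence, for one [theta] at a time. *)

Lemma exp_le (x y : R) : x <= y -> exp x <= exp y.
Proof. intros [H | ->]; [left; now apply exp_increasing | lra]. Qed.

(** * Families decaying exponentially with their derivatives *)

(* The bounds are uniform in the parameter [i], and [n] counts the controlled derivatives; only
   [x > 1] matters, which stays away from [x = 0], where poles can come arbitrarily close. *)
Fixpoint symb {I : Type} (n : nat) (a : R) (f : I -> R -> R) : Prop :=
  (exists K, forall i x, 1 < x -> Rabs (f i x) <= K * exp (- (a * x))) /\
  match n with
  | O => True
  | S m => exists f', (forall i x, 1 < x -> is_derive (f i) x (f' i x)) /\ symb m a f'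
  end.

Lemma symb_bound {I} n a (f : I -> R -> R) : symb n a f ->
  exists K, 0 <= K /\ forall i x, 1 < x -> Rabs (f i x) <= K * exp (- (a * x)).
Proof.
  intros H.
  assert (H0 : exists K, forall i x, 1 < x -> Rabs (f i x) <= K * exp (- (a * x)))
    by (destruct n; apply H).
  destruct H0 as [K HK]; exists (Rmax K 0); split; [apply Rmax_r|].
  intros i x Hx; eapply Rle_trans; [apply HK, Hx|].
  apply Rmult_le_compat_r; [left; apply exp_pos | apply Rmax_l].
Qed.

(** Since [symb] reduces only on a constructor, this form lets one tactic settle the bound in both
    cases of an induction on [n]. *)
Lemma symb_of_bound {I} n a (f : I -> R -> R) K :
  (forall i x, 1 < x -> Rabs (f i x) <= K * exp (- (a * x))) ->
  match n with
  | O => True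
  | S m => exists f', (forall i x, 1 < x -> is_derive (f i) x (f' i x)) /\ symb m a f'
  end -> symb n a f.
Proof. intros HK H; destruct n; (split; [now exists K | exact H]). Qed.

Lemma symb_derive {I} n a (f : I -> R -> R) : symb (S n) a f ->
  exists f', (forall i x, 1 < x -> is_derive (f i) x (f' i x)) /\ symb n a f'.
Proof. intros [_ H]; exact H. Qed.

Lemma symb_pred {I} n a (f : I -> R -> R) : symb (S n) a f -> symb n a f.
Proof.
  revert f; induction n as [|n IH]; intros f [[K HK] [f' [Hf' Hs]]];
    apply (symb_of_bound _ _ _ K HK); [exact Logic.I|].
  exists f'; split; [exact Hf' | now apply IH].
Qed.

Lemma symb_le {I} n a b (f : I -> R -> R) : b <= a -> symb n a f -> symb n b f.
Proof.
  intros Hba; revert f; induction n as [|n IH]; intros f H;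
    destruct (symb_bound _ _ _ H) as [K [HK0 HK]].
  all: assert (HK' : forall i x, 1 < x -> Rabs (f i x) <= K * exp (- (b * x))) by
   (intros i x Hx; eapply Rle_trans; [apply HK, Hx|];
    apply Rmult_le_compat_l; [exact HK0|];
    destruct (Req_dec a b) as [->|Hn]; [lra|];
    left; apply exp_increasing; nra).
  all: apply (symb_of_bound _ _ _ K HK').
  exact Logic.I.
  destruct (symb_derive _ _ _ H) as [f' [Hf' Hs]].
  exists f'; split; auto.
Qed.

Lemma symb_ext {I} n a (f g : I -> R -> R) :
  (forall i x, 1 < x -> f i x = g i x) -> symb n a f -> symb n a g.
Proof.
  intros Hfg H; destruct (symb_bound _ _ _ H) as [K [HK0 HK]].
  apply (symb_of_bound _ _ _ K).
  - intros i x Hx; rewrite <- Hfg by exact Hx; auto.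
  - destruct n; [exact Logic.I|].
    destruct (symb_derive _ _ _ H) as [f' [Hf' Hs]].
    exists f'; split; [|exact Hs]; intros i x Hx.
    apply is_derive_ext_loc with (2 := Hf' i x Hx).
    apply (filter_imp (fun y => 1 < y)); [intros y; apply Hfg|].
    apply (open_gt 1 x Hx).
Qed.

Lemma symb_plus {I} n a (f g : I -> R -> R) :
  symb n a f -> symb n a g -> symb n a (fun i x => f i x + g i x).
Proof.
  revert f g; induction n as [|n IH]; intros f g Hf Hg;
    destruct (symb_bound _ _ _ Hf) as [K [HK0 HK]];
    destruct (symb_bound _ _ _ Hg) as [L [HL0 HL]].
  all: apply (symb_of_bound _ _ _ (K + L));
    [intros i x Hx; rewrite Rmult_plus_distr_r; eapply Rle_trans;
     [apply Rabs_triang | apply Rplus_le_compat; auto] |].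
  exact Logic.I.
  destruct (symb_derive _ _ _ Hf) as [f' [Hf' Hsf]].
  destruct (symb_derive _ _ _ Hg) as [g' [Hg' Hsg]].
  exists (fun i x => f' i x + g' i x); split; [|now apply IH].
  intros i x Hx; apply @is_derive_plus; auto.
Qed.

Lemma symb_mult {I} n a b (f g : I -> R -> R) :
  symb n a f -> symb n b g -> symb n (a + b) (fun i x => f i x * g i x).
Proof.
  revert f g; induction n as [|n IH]; intros f g Hf Hg;
    destruct (symb_bound _ _ _ Hf) as [K [HK0 HK]];
    destruct (symb_bound _ _ _ Hg) as [L [HL0 HL]].
  all: apply (symb_of_bound _ _ _ (K * L));
    [intros i x Hx; replace (- ((a + b) * x)) with (- (a * x) + - (b * x)) by ring;
     rewrite exp_plus, Rabs_mult;
     replace (K * L * (exp (- (a * x)) * exp (- (b * x))))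
       with ((K * exp (- (a * x))) * (L * exp (- (b * x)))) by ring;
     apply Rmult_le_compat; auto using Rabs_pos |].
  exact Logic.I.
  (* The product rule contains [f] and [g] themselves, controlled here to one order less. *)
  pose proof (symb_pred _ _ _ Hf) as Hf1; pose proof (symb_pred _ _ _ Hg) as Hg1.
  destruct (symb_derive _ _ _ Hf) as [f' [Hf' Hsf]].
  destruct (symb_derive _ _ _ Hg) as [g' [Hg' Hsg]].
  exists (fun i x => f' i x * g i x + f i x * g' i x); split; [|apply symb_plus; now apply IH].
  intros i x Hx; apply (is_derive_mult (f i) (g i) x); auto.
  intros; apply Rmult_comm.
Qed.

Lemma symb_exp {I} n a (c : I -> R) C : (forall i, Rabs (c i) <= C) ->
  symb n a (fun i x => c i * exp (- (a * x))).
Proof.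
  revert c C; induction n as [|n IH]; intros c C Hc.
  all: apply (symb_of_bound _ _ _ C);
    [intros i x Hx; rewrite Rabs_mult, (Rabs_pos_eq (exp _)) by (left; apply exp_pos);
     apply Rmult_le_compat_r; [left; apply exp_pos | apply Hc] |].
  exact Logic.I.
  exists (fun i x => (c i * - a) * exp (- (a * x))); split.
  - intros i x _; auto_derive; [exact Logic.I | ring].
  - apply (IH _ (C * Rabs a)); intros i; rewrite Rabs_mult, Rabs_Ropp.
    apply Rmult_le_compat_r; [apply Rabs_pos | apply Hc].
Qed.

Lemma symb_const {I} n (c : I -> R) C : (forall i, Rabs (c i) <= C) ->
  symb n 0 (fun i _ => c i).
Proof.
  intros Hc; apply (symb_ext n 0 (fun i x => c i * exp (- (0 * x)))).
  - intros i x _; rewrite Rmult_0_l, Ropp_0, exp_0; ring.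
  - now apply (symb_exp n 0 c C).
Qed.

Lemma symb_scal {I} n a (c : I -> R) C (f : I -> R -> R) : (forall i, Rabs (c i) <= C) ->
  symb n a f -> symb n a (fun i x => c i * f i x).
Proof.
  intros Hc Hf; rewrite <- (Rplus_0_l a).
  apply (symb_mult n 0 a (fun i _ => c i)); [now apply (symb_const _ _ C) | exact Hf].
Qed.

(** The derivative [- f' / f ^ 2] involves [/ f] only to one order less, which the induction
    supplies, and rate 0 is stable under products. *)
Lemma symb_inv {I} n (f : I -> R -> R) d : 0 < d ->
  (forall i x, 1 < x -> d <= f i x) -> symb n 0 f -> symb n 0 (fun i x => / f i x).
Proof.
  intros Hd Hdf.
  assert (Hb : forall i x, 1 < x -> Rabs (/ f i x) <= / d * exp (- (0 * x))).
  { intros i x Hx; rewrite Rmult_0_l, Ropp_0, exp_0, Rmult_1_r.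
    pose proof (Hdf i x Hx).
    rewrite Rabs_pos_eq; [apply Rinv_le_contravar; lra|].
    left; apply Rinv_0_lt_compat; lra. }
  induction n as [|n IH]; intros Hf; apply (symb_of_bound _ _ _ _ Hb); [exact Logic.I|].
  pose proof (IH (symb_pred _ _ _ Hf)) as Hi.
  destruct (symb_derive _ _ _ Hf) as [f' [Hf' Hsf]].
  exists (fun i x => -1 * (f' i x * (/ f i x * / f i x))); split.
  - intros i x Hx; pose proof (Hdf i x Hx).
    evar_last; [apply is_derive_inv; [now apply Hf' | lra]|].
    simpl; field; lra.
  - apply (symb_scal n 0 (fun _ => -1) 1); [intros _; rewrite Rabs_left; lra|].
    replace 0 with (0 + (0 + 0)) by ring.
    now apply symb_mult; [|apply symb_mult].
Qed.

(** * Reciprocals of hyperbolic functions and their leading exponentials *)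

(** The difference is exactly [2 exp (- 3 x) / (1 - exp (- 2 x))], with a denominator at least
    [1 - exp (- 2)] on [x > 1]. *)
Lemma symb_inv_sinh_exp {I} n : symb n 3 (fun (_ : I) x => / sinh x - 2 * exp (- (1 * x))).
Proof.
  pose proof (exp_increasing (-2) 0 ltac:(lra)) as H2; rewrite exp_0 in H2.
  replace 3 with (3 + 0) by ring.
  apply (symb_ext n (3 + 0)
    (fun _ x => (2 * exp (- (3 * x))) * / (1 + (-1) * exp (- (2 * x))))).
  - intros i x Hx.
    pose proof (exp_pos x) as Ex.
    assert (H1 : 1 < exp x) by (rewrite <- exp_0; apply exp_increasing; lra).
    replace (exp (- (3 * x))) with (/ (exp x * (exp x * exp x)))
      by (rewrite <- !exp_plus, <- exp_Ropp; f_equal; ring).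
    replace (exp (- (2 * x))) with (/ (exp x * exp x))
      by (rewrite <- !exp_plus, <- exp_Ropp; f_equal; ring).
    unfold sinh; rewrite Rmult_1_l, exp_Ropp; field.
    repeat split; nra.
  - apply symb_mult; [apply (symb_exp n 3 (fun _ => 2) 2); intros; rewrite Rabs_pos_eq; lra|].
    apply (symb_inv n _ (1 - exp (-2))); [lra| |].
    + intros _ x Hx; assert (exp (- (2 * x)) <= exp (-2)); [|lra].
      left; apply exp_increasing; lra.
    + apply symb_plus; [apply (symb_const n (fun _ => 1) 1); intros; rewrite Rabs_pos_eq; lra|].
      apply (symb_le n 2); [lra|].
      apply (symb_exp n 2 (fun _ => -1) 1); intros; rewrite Rabs_left; lra.
Qed.

Lemma symb_inv_sinh {I} n : symb n 1 (fun (_ : I) x => / sinh x).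
Proof.
  apply (symb_ext n 1 (fun _ x => (/ sinh x - 2 * exp (- (1 * x))) + 2 * exp (- (1 * x)))).
  - intros; ring.
  - apply symb_plus; [apply (symb_le n 3); [lra | apply symb_inv_sinh_exp]|].
    apply (symb_exp n 1 (fun _ => 2) 2); intros; rewrite Rabs_pos_eq; lra.
Qed.

(** With [E = exp (- p x)] the difference equals [4 E (c E - E ^ 2 / 2) / (1 - 2 c E + E ^ 2)]. As
    [|c| <= 1], the denominator is at least [(1 - E) ^ 2 >= (1 - exp (- p)) ^ 2], whatever the value
    of [c]; this is the source of the uniformity in the angles. *)
Lemma symb_inv_cosh_sub {I} n p (c : I -> R) : 0 < p -> (forall i, Rabs (c i) <= 1) ->
  symb n (2 * p) (fun i x => / (cosh (p * x) - c i) - 2 * exp (- (p * x))).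
Proof.
  intros Hp Hc.
  assert (Hc' : forall i, -1 <= c i <= 1) by (intros i; apply Rabs_le_between, Hc).
  pose proof (exp_increasing (- p) 0 ltac:(lra)) as Hd; rewrite exp_0 in Hd.
  assert (HE : forall x, 1 < x -> exp (- (p * x)) <= exp (- p))
    by (intros x Hx; left; apply exp_increasing; nra).
  replace (2 * p) with (p + p + 0) by ring.
  apply (symb_ext n (p + p + 0) (fun i x =>
    ((4 * exp (- (p * x))) * (c i * exp (- (p * x)) + (- (1/2)) * exp (- (2 * p * x)))) *
    / (1 + ((-2 * c i) * exp (- (p * x)) + 1 * exp (- (2 * p * x)))))).
  - intros i x Hx; specialize (HE x Hx); specialize (Hc' i).
    pose proof (exp_pos (- (p * x))) as He.
    replace (exp (- (2 * p * x))) with (exp (- (p * x)) * exp (- (p * x)))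
      by (rewrite <- exp_plus; f_equal; ring).
    unfold cosh; replace (exp (p * x)) with (/ exp (- (p * x)))
      by (rewrite <- exp_Ropp; f_equal; ring).
    set (E := exp (- (p * x))) in *.
    assert (0 < 1 - 2 * c i * E + E * E) by nra.
    field; repeat split; nra.
  - apply symb_mult; [apply symb_mult|].
    + apply (symb_exp n p (fun _ => 4) 4); intros; rewrite Rabs_pos_eq; lra.
    + apply symb_plus; [now apply (symb_exp n p c 1)|].
      apply (symb_le n (2 * p)); [lra|].
      apply (symb_exp n (2 * p) (fun _ => - (1/2)) 1); intros; rewrite Rabs_left; lra.
    + apply (symb_inv n _ ((1 - exp (- p)) * (1 - exp (- p)))); [nra| |].
      * intros i x Hx; specialize (HE x Hx); specialize (Hc' i).
        replace (exp (- (2 * p * x))) with (exp (- (p * x)) * exp (- (p * x)))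
          by (rewrite <- exp_plus; f_equal; ring).
        pose proof (exp_pos (- (p * x))); nra.
      * apply symb_plus; [apply (symb_const n (fun _ => 1) 1); intros; rewrite Rabs_pos_eq; lra|].
        apply symb_plus.
        -- apply (symb_le n p); [lra|]; apply (symb_exp n p _ 2); intros i.
           specialize (Hc' i); apply Rabs_le; lra.
        -- apply (symb_le n (2 * p)); [lra|].
           apply (symb_exp n (2 * p) (fun _ => 1) 1); intros; rewrite Rabs_pos_eq; lra.
Qed.

(* [k0 / rho], [k1 / rho ^ 2], [k2 / rho ^ 3] are [h / (rho * sinh x)] and its first two
   derivatives with respect to [rho * cosh x]. *)
Lemma iterated_division_by_sinh {I} p (c : I -> R) C (h : I -> R -> R) : 0 < p <= 1 ->
  (forall i, Rabs (c i) <= C) ->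
  symb 4 (2 * p) (fun i x => h i x - c i * exp (- (p * x))) ->
  exists k0 k1 k2 k3 : I -> R -> R,
    (forall i x, 1 < x ->
      h i x = k0 i x * sinh x /\ is_derive (k0 i) x (k1 i x * sinh x) /\
      is_derive (k1 i) x (k2 i x * sinh x) /\ is_derive (k2 i) x (k3 i x) /\
      ex_derive (k3 i) x) /\
    exists K, 0 <= K /\ forall i x, 1 < x ->
      Rabs (k0 i x - 2 * c i * exp (- ((p + 1) * x))) <= K * exp (- ((2 * p + 1) * x)) /\
      Rabs (k1 i x + 4 * (p + 1) * c i * exp (- ((p + 2) * x)))
        <= K * exp (- ((2 * p + 2) * x)) /\
      Rabs (k2 i x * sinh x) <= K * exp (- ((p + 2) * x)) /\
      Rabs (k2 i x) <= K * exp (- ((p + 3) * x)) /\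
      Rabs (k3 i x) <= K * exp (- ((p + 3) * x)).
Proof.
  intros Hp Hc Hh.
  assert (Hs : forall x, 1 < x -> sinh x <> 0).
  { intros x Hx; pose proof (sinh_lt 0 x ltac:(lra)) as H.
    rewrite sinh_0 in H; lra. }
  set (v := fun (_ : I) x => / sinh x).
  set (k0 := fun i x => h i x * v i x).
  set (r0 := fun i x => k0 i x - 2 * c i * exp (- ((p + 1) * x))).
  (* Of the four derivatives, three are spent on reaching [k1], [k2] and [k3], and the last one on
     the differentiability of [k3]. *)
  assert (Sr0 : symb 4 (2 * p + 1) r0).
  { apply (symb_ext 4 _ (fun i x => (h i x - c i * exp (- (p * x))) * v i x
      + (c i * exp (- (p * x))) * (/ sinh x - 2 * exp (- (1 * x))))).
    - intros i x _; unfold r0, k0, v.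
      replace (exp (- ((p + 1) * x))) with (exp (- (p * x)) * exp (- (1 * x)))
        by (rewrite <- exp_plus; f_equal; ring).
      ring.
    - apply symb_plus; [apply symb_mult; [exact Hh | apply symb_inv_sinh]|].
      apply (symb_le 4 (p + 3)); [lra|].
      apply symb_mult; [now apply (symb_exp 4 p c C) | apply symb_inv_sinh_exp]. }
  destruct (symb_derive _ _ _ Sr0) as [r0' [Dr0 Sr0']].
  (* The leading exponential is differentiated explicitly. Dividing by [sinh] then doubles its
     coefficient and raises its rate by 1, which gives the [-4 (p + 1)] of [k1]. *)
  set (k0' := fun i x => r0' i x - 2 * (p + 1) * c i * exp (- ((p + 1) * x))).
  assert (Dk0 : forall i x, 1 < x -> is_derive (k0 i) x (k0' i x)).
  { intros i x Hx.
    apply (is_derive_ext (fun y : R => r0 i y + 2 * c i * exp (- ((p + 1) * y)))).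
    - intros y; unfold r0; simpl; ring.
    - unfold k0'; auto_derive; [eexists; apply (Dr0 i x Hx)|].
      rewrite (is_derive_unique (fun y : R => r0 i y) _ _ (Dr0 i x Hx)); ring. }
  set (k1 := fun i x => k0' i x * v i x).
  set (r1 := fun i x => k1 i x + 4 * (p + 1) * c i * exp (- ((p + 2) * x))).
  assert (Bc : forall i, Rabs (-2 * (p + 1) * c i) <= 4 * C).
  { intros i; rewrite Rabs_mult, Rabs_left by lra; pose proof (Rabs_pos (c i));
    specialize (Hc i); nra. }
  assert (Sr1 : symb 3 (2 * p + 2) r1).
  { apply (symb_ext 3 _ (fun i x => r0' i x * v i x
      + (-2 * (p + 1) * c i * exp (- ((p + 1) * x))) * (/ sinh x - 2 * exp (- (1 * x))))).
    - intros i x _; unfold r1, k1, k0', v.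
      replace (exp (- ((p + 2) * x))) with (exp (- ((p + 1) * x)) * exp (- (1 * x)))
        by (rewrite <- exp_plus; f_equal; ring).
      ring.
    - apply symb_plus.
      + replace (2 * p + 2) with (2 * p + 1 + 1) by ring.
        apply symb_mult; [exact Sr0' | apply symb_inv_sinh].
      + apply (symb_le 3 (p + 1 + 3)); [lra|].
        apply symb_mult; [now apply (symb_exp 3 (p + 1) _ (4 * C)) | apply symb_inv_sinh_exp]. }
  assert (Sk1 : symb 3 (p + 2) k1).
  { apply (symb_ext 3 _ (fun i x => r1 i x + (-4 * (p + 1) * c i) * exp (- ((p + 2) * x)))).
    - intros i x _; unfold r1; ring.
    - apply symb_plus; [apply (symb_le 3 (2 * p + 2)); [lra | exact Sr1]|].
      apply (symb_exp 3 (p + 2) _ (8 * C)); intros i.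
      replace (-4 * (p + 1) * c i) with (2 * (-2 * (p + 1) * c i)) by ring.
      rewrite Rabs_mult, (Rabs_pos_eq 2) by lra; specialize (Bc i); lra. }
  destruct (symb_derive _ _ _ Sk1) as [k1' [Dk1 Sk1']].
  (* From here on only the size matters, because [k2] and [k3] enter remainders or boundary terms
     that vanish at [B]. *)
  set (k2 := fun i x => k1' i x * v i x).
  assert (Sk2 : symb 2 (p + 3) k2).
  { replace (p + 3) with (p + 2 + 1) by ring.
    apply symb_mult; [exact Sk1' | apply symb_inv_sinh]. }
  destruct (symb_derive _ _ _ Sk2) as [k3 [Dk2 Sk3]].
  destruct (symb_derive _ _ _ Sk3) as [k3' [Dk3 _]].
  assert (Ev : forall i x y, 1 < x -> y * v i x * sinh x = y)
    by (intros i x y Hx; unfold v; field; auto).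
  exists k0, k1, k2, k3; split.
  - intros i x Hx; unfold k0 at 1, k1 at 1, k2 at 1; rewrite !Ev by exact Hx.
    split; [reflexivity|]; split; [auto|]; split; [auto|]; split; [auto|].
    exists (k3' i x); auto.
  - destruct (symb_bound _ _ _ Sr0) as [K0 [P0 B0]].
    destruct (symb_bound _ _ _ Sr1) as [K1 [P1 B1]].
    destruct (symb_bound _ _ _ Sk1') as [K2 [P2 B2]].
    destruct (symb_bound _ _ _ Sk2) as [K3 [P3 B3]].
    destruct (symb_bound _ _ _ Sk3) as [K4 [P4 B4]].
    exists (K0 + K1 + K2 + K3 + K4); split; [lra|].
    assert (M : forall y z L, y <= L * exp z -> L <= K0 + K1 + K2 + K3 + K4 ->
              y <= (K0 + K1 + K2 + K3 + K4) * exp z).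
    { intros y z L H1 H2; pose proof (exp_pos z); nra. }
    intros i x Hx; unfold k2 at 1; rewrite Ev by exact Hx; repeat split.
    + apply (M _ _ K0); [apply (B0 i x Hx) | lra].
    + apply (M _ _ K1); [apply (B1 i x Hx) | lra].
    + apply (M _ _ K2); [apply (B2 i x Hx) | lra].
    + apply (M _ _ K3); [apply (B3 i x Hx) | lra].
    + apply (M _ _ K4); [apply (B4 i x Hx) | lra].
Qed.
(** * Oscillatory integrals *)

Lemma is_lim_exp_neg (K a : R) : 0 < a -> is_lim (fun x => K * exp (- (a * x))) p_infty 0.
Proof.
  intros Ha.
  replace (Finite 0) with (Rbar_mult K 0) by (simpl; f_equal; ring).
  apply is_lim_scal_l.
  apply filterlim_comp with (G := Rbar_locally m_infty) (g := exp);
    [|apply is_lim_exp_m].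
  intros Q [M HM]; exists (- M / a); intros x Hx; apply HM.
  apply (Rmult_lt_compat_l a) in Hx; [|exact Ha].
  replace (a * (- M / a)) with (- M) in Hx by (field; lra); lra.
Qed.

Lemma is_lim_of_exp_bound (f : R -> R) (K a B : R) : 0 < a ->
  (forall x, B < x -> Rabs (f x) <= K * exp (- (a * x))) -> is_lim f p_infty 0.
Proof.
  intros Ha Hf.
  apply (is_lim_le_le_loc (fun x => (- K) * exp (- (a * x))) (fun x => K * exp (- (a * x))));
    try now apply is_lim_exp_neg.
  exists B; intros x Hx; specialize (Hf x Hx); apply Rabs_le_between in Hf; lra.
Qed.

Lemma is_lim_bounded_mult (u k : R -> R) : (forall x, Rabs (u x) <= 1) ->
  is_lim k p_infty 0 -> is_lim (fun x => u x * k x) p_infty 0.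
Proof.
  intros Hu Hk.
  apply is_lim_Rabs in Hk; simpl in Hk; rewrite Rabs_R0 in Hk.
  apply (is_lim_le_le_loc (fun x => - Rabs (k x)) (fun x => Rabs (k x))).
  - exists 0; intros x _; specialize (Hu x).
    apply Rabs_le_between; rewrite Rabs_mult.
    pose proof (Rabs_pos (k x)); nra.
  - replace (Finite 0) with (Rbar_opp 0) by (simpl; f_equal; ring); now apply is_lim_opp.
  - exact Hk.
Qed.

Lemma is_RInt_exp_neg (K a B b : R) : 0 < a ->
  is_RInt (fun x => K * exp (- (a * x))) B b
    (K / a * exp (- (a * B)) - K / a * exp (- (a * b))).
Proof.
  intros Ha.
  replace (K / a * exp (- (a * B)) - K / a * exp (- (a * b)))
    with (minus ((- K / a) * exp (- (a * b))) ((- K / a) * exp (- (a * B))))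
    by (unfold minus, plus, opp; simpl; field; lra).
  apply (is_RInt_derive (fun x => (- K / a) * exp (- (a * x)))).
  - intros x _; auto_derive; [exact Logic.I | field; lra].
  - intros x _; apply (ex_derive_continuous (fun x => K * exp (- (a * x)))).
    auto_derive; exact Logic.I.
Qed.

Lemma RInt_exp_bound (e : R -> R) (K a B b : R) : 0 < a -> B <= b -> 0 <= K ->
  (forall x, B <= x -> continuous e x) ->
  (forall x, B <= x -> Rabs (e x) <= K * exp (- (a * x))) ->
  Rabs (RInt e B b) <= K / a * exp (- (a * B)).
Proof.
  intros Ha Hb HK Ce He.
  assert (Ie : ex_RInt e B b).
  { apply (ex_RInt_continuous (V := R_CompleteNormedModule)); intros z Hz.
    rewrite Rmin_left in Hz by exact Hb; apply Ce; lra. }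
  apply Rle_trans with (RInt (fun x => K * exp (- (a * x))) B b).
  - apply (norm_RInt_le e (fun x => K * exp (- (a * x))) B b); [exact Hb| | |].
    + intros x Hx; apply He; lra.
    + apply (RInt_correct e), Ie.
    + apply (RInt_correct (fun x => K * exp (- (a * x)))); eexists; apply (is_RInt_exp_neg K a B b Ha).
  - rewrite (is_RInt_unique _ _ _ _ (is_RInt_exp_neg K a B b Ha)).
    pose proof (exp_pos (- (a * b))); assert (0 <= K / a) by (apply Rdiv_le_0_compat; lra); nra.
Qed.

(** Repeated integration by parts in a single step: [P] collects all the boundary terms and [e] is
    the error left over. The integral of [f] over [[B, b]] is [P b - P B] minus that of [e], and the
    last one is bounded uniformly in [b], so its limit never has to be formed. *)
Lemma primitive_up_to_error (f e P : R -> R) (B K a L : R) : 0 < a -> 0 <= K ->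
  (forall x, B <= x -> is_derive P x (f x + e x)) ->
  (forall x, B <= x -> continuous f x) ->
  (forall x, B <= x -> continuous e x) ->
  (forall x, B <= x -> Rabs (e x) <= K * exp (- (a * x))) ->
  is_lim P p_infty 0 ->
  is_lim (fun b => RInt f B b) p_infty L ->
  Rabs (L + P B) <= K / a * exp (- (a * B)).
Proof.
  intros Ha HK DP Cf Ce He LP LI.
  assert (HL : is_lim (fun b => Rabs (RInt f B b - P b + P B)) p_infty (Rabs (L - 0 + P B))).
  { apply (is_lim_Rabs _ _ (Finite (L - 0 + P B))).
    apply is_lim_plus'; [now apply is_lim_minus' | apply is_lim_const]. }
  rewrite Rminus_0_r in HL.
  refine (is_lim_le_loc _ (fun _ => K / a * exp (- (a * B))) p_infty _
    (K / a * exp (- (a * B))) _ HL (is_lim_const _ _)).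
  exists B; intros b Hb.
  assert (ex : forall g : R -> R, (forall x, B <= x -> continuous g x) -> ex_RInt g B b).
  { intros g Cg; apply (ex_RInt_continuous (V := R_CompleteNormedModule)); intros z Hz.
    rewrite Rmin_left in Hz by lra; apply Cg; lra. }
  assert (E : RInt f B b + RInt e B b = P b - P B).
  { transitivity (RInt (fun x => f x + e x) B b).
    - symmetry; apply is_RInt_unique, (is_RInt_plus f e B b);
        [apply (RInt_correct f) | apply (RInt_correct e)]; auto.
    - apply is_RInt_unique, (is_RInt_derive P (fun x => f x + e x)); intros x Hx;
        rewrite Rmin_left in Hx by lra; [apply DP; lra|].
      apply (continuous_plus f e); [apply Cf | apply Ce]; lra. }
  replace (RInt f B b - P b + P B) with (- RInt e B b) by lra.
  rewrite Rabs_Ropp; apply RInt_exp_bound; auto; lra.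
Qed.

Section Oscillation.

(** In this section [p] is the decay rate of the remainder, later [2 q + 2] for the sine and
    [2 q + 3] for the cosine, not the rate of the kernel. By [Ht] the phase [X] vanishes at [B], so
    only the cosine terms of [P] survive there. *)
Variables (k0 k1 k2 k3 : R -> R) (omega rho t B p K : R).
Hypotheses (Hw : 0 < omega) (Hr : 0 < rho) (HB : 1 < B) (Hp : 0 < p) (HK : 0 <= K)
  (Ht : t = rho * cosh B).
Hypotheses
  (D0 : forall x, 1 < x -> is_derive k0 x (k1 x * sinh x))
  (D1 : forall x, 1 < x -> is_derive k1 x (k2 x * sinh x))
  (D2 : forall x, 1 < x -> is_derive k2 x (k3 x))
  (D3 : forall x, 1 < x -> ex_derive k3 x)
  (L0 : is_lim k0 p_infty 0) (L1 : is_lim k1 p_infty 0) (L2 : is_lim k2 p_infty 0).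

Let X x := omega * (rho * cosh x - t).

Local Lemma is_derive_X x : is_derive X x (omega * rho * sinh x).
Proof.
  unfold X; auto_derive; [exact Logic.I | ring].
Qed.

Local Lemma ex_derive_k x : 1 < x -> ex_derive k0 x /\ ex_derive k1 x /\ ex_derive k2 x.
Proof.
  intros Hx; repeat split; eexists; [now apply D0 | now apply D1 | now apply D2].
Qed.

(** One integration by parts already produces the boundary term [k0 B], but leaves an integral of
    [k1 * sinh], of the same order when [k1] is one power of [exp (- x)] smaller than [k0]. The
    second one adds no boundary value, since [sin (X B) = 0]. *)
Lemma sine_integral_estimate (S : R) :
  (forall x, 1 < x -> Rabs (k2 x * sinh x) <= K * exp (- (p * x))) ->
  is_lim (fun b => RInt (fun x => sin (X x) * (k0 x * sinh x)) B b) p_infty S ->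
  Rabs (S - k0 B / (omega * rho)) <= K / (omega * rho) ^ 2 / p * exp (- (p * B)).
Proof.
  intros Hk HS.
  (* Two integrations by parts in the variable [rho * cosh x]. *)
  set (P := fun x => cos (X x) * (- k0 x / (omega * rho)) + sin (X x) * (k1 x / (omega * rho) ^ 2)).
  assert (HPB : P B = - k0 B / (omega * rho)).
  { unfold P, X; rewrite Ht; replace (omega * (rho * cosh B - rho * cosh B)) with 0 by ring.
    rewrite cos_0, sin_0; ring. }
  replace (S - k0 B / (omega * rho)) with (S + P B) by (rewrite HPB; field; lra).
  assert (W : 0 < omega * rho) by nra.
  assert (W2 : 0 < (omega * rho) ^ 2) by nra.
  apply (primitive_up_to_error (fun x => sin (X x) * (k0 x * sinh x))
    (fun x => sin (X x) * (k2 x * sinh x / (omega * rho) ^ 2)) P); auto.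
  - apply Rdiv_le_0_compat; lra.
  - intros x Hx; destruct (ex_derive_k x ltac:(lra)) as [E0 [E1 E2]].
    unfold P; auto_derive.
    + repeat split; auto; exists (omega * rho * sinh x); apply is_derive_X.
    + rewrite (is_derive_unique (fun x : R => X x) _ _ (is_derive_X x)),
        (is_derive_unique (fun x : R => k0 x) _ _ (D0 x ltac:(lra))),
        (is_derive_unique (fun x : R => k1 x) _ _ (D1 x ltac:(lra))); field; lra.
  - intros x Hx; destruct (ex_derive_k x ltac:(lra)) as [E0 [E1 E2]].
    apply (ex_derive_continuous (fun x => sin (X x) * (k0 x * sinh x))); auto_derive.
    repeat split; auto; eexists; apply is_derive_X.
  - intros x Hx; destruct (ex_derive_k x ltac:(lra)) as [E0 [E1 E2]].
    apply (ex_derive_continuous (fun x => sin (X x) * (k2 x * sinh x / (omega * rho) ^ 2)));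
      auto_derive.
    repeat split; auto; try lra; eexists; apply is_derive_X.
  - intros x Hx; rewrite Rabs_mult.
    unfold Rdiv; rewrite Rabs_mult, (Rabs_pos_eq (/ _)) by (left; apply Rinv_0_lt_compat, W2).
    specialize (Hk x ltac:(lra)).
    assert (Rabs (sin (X x)) <= 1) by apply Rabs_le, SIN_bound.
    pose proof (Rabs_pos (sin (X x))); pose proof (Rabs_pos (k2 x * sinh x)).
    pose proof (Rinv_0_lt_compat _ W2).
    apply Rle_trans with (1 * (K * exp (- (p * x)) * / (omega * rho) ^ 2)); [|right; ring].
    apply Rmult_le_compat; auto; [apply Rmult_le_pos; lra|].
    apply Rmult_le_compat_r; lra.
  - replace (Finite 0) with (Finite (0 + 0)) by (f_equal; ring); apply is_lim_plus'.
    + apply is_lim_bounded_mult; [intros; apply Rabs_le, COS_bound|].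
      apply (is_lim_ext (fun x => (- / (omega * rho)) * k0 x)); [intros; field; lra|].
      replace (Finite 0) with (Rbar_mult (- / (omega * rho)) 0) by (simpl; f_equal; ring).
      now apply is_lim_scal_l.
    + apply is_lim_bounded_mult; [intros; apply Rabs_le, SIN_bound|].
      apply (is_lim_ext (fun x => (/ (omega * rho) ^ 2) * k1 x)); [intros; field; lra|].
      replace (Finite 0) with (Rbar_mult (/ (omega * rho) ^ 2) 0) by (simpl; f_equal; ring).
      now apply is_lim_scal_l.
Qed.

(** The boundary terms with [k0] and [k2] carry [sin X] and vanish at [B], so [k1 B] leads. Stopping
    after two integrations by parts would leave [k2 * sinh], in the application of the same order as
    [k1]. *)
Lemma cosine_integral_estimate (S : R) :
  (forall x, 1 < x -> Rabs (k3 x) <= K * exp (- (p * x))) ->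
  is_lim (fun b => RInt (fun x => cos (X x) * (k0 x * sinh x)) B b) p_infty S ->
  Rabs (S + k1 B / (omega * rho) ^ 2) <= K / (omega * rho) ^ 3 / p * exp (- (p * B)).
Proof.
  intros Hk HS.
  (* Three integrations by parts in the variable [rho * cosh x]. *)
  set (P := fun x => sin (X x) * (k0 x / (omega * rho)) + cos (X x) * (k1 x / (omega * rho) ^ 2)
     + sin (X x) * (- k2 x / (omega * rho) ^ 3)).
  assert (HPB : P B = k1 B / (omega * rho) ^ 2).
  { unfold P, X; rewrite Ht; replace (omega * (rho * cosh B - rho * cosh B)) with 0 by ring.
    rewrite cos_0, sin_0; ring. }
  rewrite <- HPB.
  assert (W : 0 < omega * rho) by nra.
  assert (W2 : 0 < (omega * rho) ^ 2) by nra.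
  assert (W3 : 0 < (omega * rho) ^ 3) by now apply pow_lt.
  apply (primitive_up_to_error (fun x => cos (X x) * (k0 x * sinh x))
    (fun x => sin (X x) * (- k3 x / (omega * rho) ^ 3)) P); auto.
  - apply Rdiv_le_0_compat; lra.
  - intros x Hx; destruct (ex_derive_k x ltac:(lra)) as [E0 [E1 E2]].
    unfold P; auto_derive.
    + repeat split; auto; exists (omega * rho * sinh x); apply is_derive_X.
    + rewrite (is_derive_unique (fun x : R => X x) _ _ (is_derive_X x)),
        (is_derive_unique (fun x : R => k0 x) _ _ (D0 x ltac:(lra))),
        (is_derive_unique (fun x : R => k1 x) _ _ (D1 x ltac:(lra))),
        (is_derive_unique (fun x : R => k2 x) _ _ (D2 x ltac:(lra))); field; lra.
  - intros x Hx; destruct (ex_derive_k x ltac:(lra)) as [E0 [E1 E2]].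
    apply (ex_derive_continuous (fun x => cos (X x) * (k0 x * sinh x))); auto_derive.
    repeat split; auto; eexists; apply is_derive_X.
  - intros x Hx; pose proof (D3 x ltac:(lra)) as E3.
    apply (ex_derive_continuous (fun x => sin (X x) * (- k3 x / (omega * rho) ^ 3)));
      auto_derive.
    repeat split; auto; try lra; eexists; apply is_derive_X.
  - intros x Hx; rewrite Rabs_mult.
    unfold Rdiv; rewrite Rabs_mult, Rabs_Ropp, (Rabs_pos_eq (/ _))
      by (left; apply Rinv_0_lt_compat, W3).
    specialize (Hk x ltac:(lra)).
    assert (Rabs (sin (X x)) <= 1) by apply Rabs_le, SIN_bound.
    pose proof (Rabs_pos (sin (X x))); pose proof (Rabs_pos (k3 x)).
    pose proof (Rinv_0_lt_compat _ W3).
    apply Rle_trans with (1 * (K * exp (- (p * x)) * / (omega * rho) ^ 3)); [|right; ring].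
    apply Rmult_le_compat; auto; [apply Rmult_le_pos; lra|].
    apply Rmult_le_compat_r; lra.
  - assert (Z : forall c k, is_lim k p_infty 0 -> is_lim (fun x => c * k x) p_infty 0).
    { intros c k Lk; replace (Finite 0) with (Rbar_mult c 0) by (simpl; f_equal; ring).
      now apply is_lim_scal_l. }
    replace (Finite 0) with (Finite (0 + 0 + 0)) by (f_equal; ring);
      apply is_lim_plus'; [apply is_lim_plus'|].
    + apply is_lim_bounded_mult; [intros; apply Rabs_le, SIN_bound|].
      apply (is_lim_ext (fun x => (/ (omega * rho)) * k0 x)); [intros; field; lra|].
      now apply Z.
    + apply is_lim_bounded_mult; [intros; apply Rabs_le, COS_bound|].
      apply (is_lim_ext (fun x => (/ (omega * rho) ^ 2) * k1 x)); [intros; field; lra|].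
      now apply Z.
    + apply is_lim_bounded_mult; [intros; apply Rabs_le, SIN_bound|].
      apply (is_lim_ext (fun x => (- / (omega * rho) ^ 3) * k2 x)); [intros; field; lra|].
      now apply Z.
Qed.

End Oscillation.
(** * Tails of integrals over the line *)

Lemma ex_lim_RInt_exp_bound (f : R -> R) (K a : R) : 0 < a ->
  (forall x, continuous f x) ->
  (forall x, 1 <= x -> Rabs (f x) <= K * exp (- (a * x))) ->
  exists L : R, is_lim (fun b => RInt f 0 b) p_infty L.
Proof.
  intros Ha Cf Bf.
  assert (HK : 0 <= K).
  { pose proof (Bf 1 ltac:(lra)); pose proof (Rabs_pos (f 1)); pose proof (exp_pos (- (a * 1))); nra. }
  assert (ex : forall x y, ex_RInt f x y) by (intros; now apply (ex_RInt_continuous (V := R_CompleteNormedModule))).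
  apply (filterlim_locally_cauchy (U := R_CompleteSpace) (F := Rbar_locally p_infty)).
  intros eps.
  destruct (proj2 (is_lim_spec _ _ _) (is_lim_exp_neg (K / a) a Ha) eps) as [A HA].
  exists (fun x => Rmax A 1 + 1 <= x); split; [exists (Rmax A 1 + 1); intros; lra|].
  assert (main : forall u v, Rmax A 1 + 1 <= u -> u <= v ->
      Rabs (RInt f 0 v - RInt f 0 u) < eps).
  { intros u v Hu Huv; pose proof (Rmax_l A 1); pose proof (Rmax_r A 1).
    assert (E : RInt f 0 v - RInt f 0 u = RInt f u v).
    { rewrite <- (RInt_Chasles f 0 u v (ex _ _) (ex _ _)); unfold plus; simpl; ring. }
    rewrite E; eapply Rle_lt_trans; [apply (RInt_exp_bound f K a); auto|].
    - intros x Hx; apply Bf; lra.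
    - specialize (HA u ltac:(lra)); simpl in HA; rewrite Rminus_0_r in HA.
      eapply Rle_lt_trans; [apply Rle_abs | exact HA]. }
  intros u v Hu Hv.
  change (Rabs (RInt f 0 v - RInt f 0 u) < eps).
  destruct (Rle_dec u v); [now apply main|].
  rewrite Rabs_minus_sym; apply main; lra.
Qed.

Lemma is_derive_RInt0 (f : R -> R) (Cf : forall x, continuous f x) x :
  is_derive (fun b => RInt f 0 b) x (f x).
Proof.
  apply (is_derive_RInt f (fun b => RInt f 0 b) 0 x); [|apply Cf].
  apply filter_forall; intros y; apply (RInt_correct f).
  now apply (ex_RInt_continuous (V := R_CompleteNormedModule)).
Qed.

(** [RInt_gen] is a total function, so its values mean something only once both integrals are shown
    to converge. The difference is then the integral of [f] over [|x| > B], folded onto the positive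
    half-line. The values of [g] at [B] and [- B] are left free, as the jump of the cut-off sits
    there. *)
Lemma RInt_gen_tail (f g : R -> R) (B K a : R) : 0 < a -> 0 < B ->
  (forall x, continuous f x) ->
  (forall x, 1 <= Rabs x -> Rabs (f x) <= K * exp (- (a * Rabs x))) ->
  (forall x, Rabs x < B -> g x = f x) ->
  (forall x, B < Rabs x -> g x = 0) ->
  is_lim (fun b => RInt (fun x => f x + f (- x)) B b) p_infty
    (RInt_gen f (Rbar_locally m_infty) (Rbar_locally p_infty)
     - RInt_gen g (Rbar_locally m_infty) (Rbar_locally p_infty)).
Proof.
  intros Ha HB Cf Bf Gf G0.
  set (F := fun b => RInt f 0 b).
  assert (DF : forall x, is_derive F x (f x)) by (intros; now apply is_derive_RInt0).
  assert (IF : forall x y, is_RInt f x y (F y - F x)).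
  { intros x y; apply (is_RInt_derive F f); auto. }
  destruct (ex_lim_RInt_exp_bound f K a Ha Cf) as [L1 H1].
  { intros x Hx; rewrite <- (Rabs_pos_eq x) at 2 by lra; apply Bf.
    rewrite Rabs_pos_eq; lra. }
  assert (Cn : forall x, continuous (fun y => f (- y)) x).
  { intros x; apply (continuous_comp (fun y : R => - y) f); [|apply Cf].
    apply (ex_derive_continuous (fun y : R => - y)); auto_derive; exact Logic.I. }
  destruct (ex_lim_RInt_exp_bound (fun x => f (- x)) K a Ha Cn) as [L2 H2].
  { intros x Hx; assert (E : Rabs (- x) = x) by (rewrite Rabs_Ropp; apply Rabs_pos_eq; lra).
    rewrite <- E at 2; apply Bf; lra. }
  assert (EN : forall b, RInt (fun x => f (- x)) 0 b = - F (- b)).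
  { intros b; apply is_RInt_unique.
    replace (- F (- b)) with (minus (G := R_AbelianGroup) (- F (- b)) (- F (- 0))).
    - apply (is_RInt_derive (fun x => - F (- x))); [|auto].
      intros x _; auto_derive; [eexists; apply DF|].
      rewrite (is_derive_unique (fun x : R => F x) _ _ (DF (- x))); ring.
    - rewrite Ropp_0; unfold F at 2; rewrite RInt_point.
      unfold minus, plus, opp, zero; simpl; ring. }
  (* [F] tends to [L1] at plus infinity and, by [EN], to [- L2] at minus infinity. *)
  assert (If : is_RInt_gen f (Rbar_locally m_infty) (Rbar_locally p_infty) (L1 - - L2)).
  { apply (is_RInt_gen_ext (Derive F)).
    - apply filter_forall; intros ab x _; apply is_derive_unique, DF.
    - apply is_RInt_gen_Derive.
      + apply filter_forall; intros ab x _; eexists; apply DF.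
      + apply filter_forall; intros ab x _.
        apply (continuous_ext f); [intros y; symmetry; apply is_derive_unique, DF | apply Cf].
      + apply (filterlim_ext (fun b => - RInt (fun x => f (- x)) 0 (- b))).
        { intros b; rewrite EN, !Ropp_involutive; reflexivity. }
        apply (filterlim_comp _ _ _ _ Ropp _ (locally L2));
          [|apply (filterlim_opp L2)].
        apply (filterlim_comp _ _ _ Ropp _ _ (Rbar_locally p_infty)); [|exact H2].
        apply (filterlim_Rbar_opp m_infty).
      + exact H1. }
  (* Once the endpoints lie outside [[- B, B]], the integral of [g] is constant, so the limit is
     attained. *)
  assert (Ig : is_RInt_gen g (Rbar_locally m_infty) (Rbar_locally p_infty) (F B - F (- B))).
  { intros P HP.
    apply (Filter_prod _ _ _ (fun x => x < - B) (fun x => B < x));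
      [now exists (- B) | now exists B |].
    intros x y Hx Hy; exists (F B - F (- B)); split; [|now apply locally_singleton].
    simpl fst; simpl snd.
    replace (F B - F (- B)) with (plus (plus 0 (F B - F (- B))) 0)
      by (unfold plus; simpl; ring).
    assert (Z : forall u v, is_RInt (fun _ : R => 0) u v 0).
    { intros u v; evar_last; [apply (is_RInt_const (V := R_NormedModule)) | apply Rmult_0_r]. }
    apply (is_RInt_Chasles g x B y); [apply (is_RInt_Chasles g x (- B) B)|].
    - apply (is_RInt_ext (fun _ => 0)); [|apply Z].
      intros z; rewrite Rmin_left, Rmax_right by lra; intros Hz; symmetry; apply G0.
      rewrite Rabs_left; lra.
    - apply (is_RInt_ext f); [|apply IF].
      intros z; rewrite Rmin_left, Rmax_right by lra; intros Hz; symmetry; apply Gf.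
      apply Rabs_def1; lra.
    - apply (is_RInt_ext (fun _ => 0)); [|apply Z].
      intros z; rewrite Rmin_left, Rmax_right by lra; intros Hz; symmetry; apply G0.
      rewrite Rabs_right; lra. }
  rewrite (is_RInt_gen_unique _ _ If), (is_RInt_gen_unique _ _ Ig).
  apply (is_lim_ext (fun b => RInt f 0 b - - RInt (fun x => f (- x)) 0 b - (F B - F (- B)))).
  - intros b; symmetry; apply is_RInt_unique; rewrite EN.
    replace (RInt f 0 b - - - F (- b) - (F B - F (- B)))
      with (plus (F b - F B) (- F (- b) - - F (- B))) by (unfold plus, F; simpl; ring).
    apply (is_RInt_plus f (fun x => f (- x))); [apply IF|].
    apply (is_RInt_derive (fun x => - F (- x))); [|auto].
    intros x _; auto_derive; [eexists; apply DF|].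
    rewrite (is_derive_unique (fun x : R => F x) _ _ (DF (- x))); ring.
  - apply is_lim_minus'; [|apply is_lim_const].
    apply is_lim_minus'; [exact H1|].
    apply (is_lim_opp _ _ (Finite L2)), H2.
Qed.
(** * The kernel on the contour *)

Lemma cosh_opp x : cosh (- x) = cosh x.
Proof. unfold cosh; rewrite Ropp_involutive; field. Qed.

Lemma sinh_opp x : sinh (- x) = - sinh x.
Proof. unfold sinh; rewrite Ropp_involutive; field. Qed.

Lemma cosh_sqr x : cosh x * cosh x = 1 + sinh x * sinh x.
Proof.
  unfold cosh, sinh; assert (exp x * exp (- x) = 1) by (rewrite <- exp_plus, Rplus_opp_r; apply exp_0).
  nra.
Qed.

Lemma cosh_ge_1 x : 1 <= cosh x.
Proof.
  pose proof (cosh_sqr x); assert (0 < cosh x); [|nra].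
  unfold cosh; pose proof (exp_pos x); pose proof (exp_pos (- x)); lra.
Qed.

Lemma cosh_Rabs x : cosh (Rabs x) = cosh x.
Proof. unfold Rabs; destruct (Rcase_abs x); [apply cosh_opp | reflexivity]. Qed.

Lemma cosh_lt x y : Rabs x < y -> cosh x < cosh y.
Proof.
  intros H; rewrite <- cosh_Rabs.
  pose proof (cosh_sqr (Rabs x)); pose proof (cosh_sqr y).
  pose proof (cosh_ge_1 (Rabs x)); pose proof (cosh_ge_1 y).
  pose proof (sinh_lt _ _ H).
  assert (0 <= sinh (Rabs x)).
  { rewrite <- sinh_0; destruct (Rabs_pos x) as [Hx|<-]; [left; now apply sinh_lt | right; reflexivity]. }
  nra.
Qed.

Lemma Csinh_re_im x y : Csinh (x, y) = (sinh x * cos y, cosh x * sin y).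
Proof.
  unfold Csinh, Cexp, sinh, cosh; apply injective_projections; simpl;
    rewrite ?cos_neg, ?sin_neg; field.
Qed.

Lemma Ccosh_re_im x y : Ccosh (x, y) = (cosh x * cos y, sinh x * sin y).
Proof.
  unfold Ccosh, Cexp, sinh, cosh; apply injective_projections; simpl;
    rewrite ?cos_neg, ?sin_neg; field.
Qed.

Lemma Ccoth_re_im x y : cosh (2 * x) - cos (2 * y) <> 0 ->
  Ccoth (x, y) = (sinh (2 * x) * / (cosh (2 * x) - cos (2 * y)),
                  - (sin (2 * y) * / (cosh (2 * x) - cos (2 * y)))).
Proof.
  unfold Ccoth; rewrite Ccosh_re_im, Csinh_re_im.
  pose proof (cosh_sqr x) as Hc; pose proof (sin2_cos2 y) as Hs; unfold Rsqr in Hs.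
  assert (E : cosh (2 * x) = 1 + 2 * (sinh x * sinh x)).
  { unfold cosh, sinh; replace (- (2 * x)) with (- x + - x) by ring.
    replace (2 * x) with (x + x) by ring; rewrite !exp_plus.
    assert (exp x * exp (- x) = 1) by (rewrite <- exp_plus, Rplus_opp_r; apply exp_0).
    nra. }
  assert (E' : sinh (2 * x) = 2 * (sinh x * cosh x)).
  { unfold cosh, sinh; replace (- (2 * x)) with (- x + - x) by ring.
    replace (2 * x) with (x + x) by ring; rewrite !exp_plus; field. }
  rewrite E, E', cos_2a_sin, sin_2a; intros HD.
  set (a := sinh x) in *; set (b := cosh x) in *; set (c := cos y) in *; set (s := sin y) in *.
  (* This is [|sinh z| ^ 2], the denominator of the complex division; twice it is
     [cosh (2 x) - cos (2 y)]. *)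
  assert (Hd : (a * c) ^ 2 + (b * s) ^ 2 = a * a + s * s).
  { replace ((a * c) ^ 2 + (b * s) ^ 2) with (a * a * (c * c) + b * b * (s * s)) by ring.
    rewrite Hc; replace (c * c) with (1 - s * s) by lra; ring. }
  assert (Hd0 : a * a + s * s <> 0) by (intros H0; apply HD; lra).
  apply injective_projections; simpl.
  - replace (a * c * (a * c * 1) + b * s * (b * s * 1)) with (a * a + s * s)
      by (rewrite <- Hd; ring).
    replace (1 + 2 * (a * a) - (1 - 2 * s * s)) with (2 * (a * a + s * s)) by ring.
    transitivity (a * b * (s * s + c * c) / (a * a + s * s)); [field; exact Hd0|].
    rewrite Hs; field; exact Hd0.
  - replace (a * c * (a * c * 1) + b * s * (b * s * 1)) with (a * a + s * s)
      by (rewrite <- Hd; ring).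
    replace (1 + 2 * (a * a) - (1 - 2 * s * s)) with (2 * (a * a + s * s)) by ring.
    transitivity (- (b * b - a * a) * s * c / (a * a + s * s)); [field; exact Hd0|].
    replace (b * b - a * a) with 1 by lra; field; exact Hd0.
Qed.

(* The real and imaginary parts of [Z_N] on the contour: the four
   coth's have the arguments [(p * x + i * y_j) / 2], the last two entering with a minus sign. *)
Definition Zre (p y1 y2 y3 y4 x : R) : R :=
  sinh (p * x) * (/ (cosh (p * x) - cos y1) + / (cosh (p * x) - cos y2)
                  - / (cosh (p * x) - cos y3) - / (cosh (p * x) - cos y4)).

Definition Zim (p y1 y2 y3 y4 x : R) : R :=
  - (sin y1 * / (cosh (p * x) - cos y1) + sin y2 * / (cosh (p * x) - cos y2)
     - sin y3 * / (cosh (p * x) - cos y3) - sin y4 * / (cosh (p * x) - cos y4)).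

(** Each reciprocal contributes [2 exp (- p x)], and folding the line doubles it, whence the factor
    4. *)
Lemma symb_Zim {I} n p (y1 y2 y3 y4 : I -> R) : 0 < p ->
  symb n (2 * p) (fun i x => 2 * Zim p (y1 i) (y2 i) (y3 i) (y4 i) x
    - 4 * (sin (y3 i) + sin (y4 i) - sin (y1 i) - sin (y2 i)) * exp (- (p * x))).
Proof.
  intros Hp.
  assert (S : forall (y : I -> R) e, Rabs e <= 2 -> symb n (2 * p) (fun i x =>
      (e * sin (y i)) * (/ (cosh (p * x) - cos (y i)) - 2 * exp (- (p * x))))).
  { intros y e He; apply (symb_scal n (2 * p) _ (2 * 1)).
    - intros i; rewrite Rabs_mult; apply Rmult_le_compat; try apply Rabs_pos; [exact He|].
      apply Rabs_le, SIN_bound.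
    - apply symb_inv_cosh_sub; [exact Hp|]; intros i; apply Rabs_le, COS_bound. }
  assert (E1 : Rabs (-2) <= 2) by (rewrite Rabs_left; lra).
  assert (E2 : Rabs 2 <= 2) by (rewrite Rabs_pos_eq; lra).
  eapply symb_ext; [|exact (symb_plus _ _ _ _
    (symb_plus _ _ _ _ (S y1 (-2) E1) (S y2 (-2) E1))
    (symb_plus _ _ _ _ (S y3 2 E2) (S y4 2 E2)))].
  intros i x _; unfold Zim; simpl; ring.
Qed.

Section Kernel.

Variables (p y1 y2 y3 y4 : R).
Hypotheses (Hp : 0 < p) (N1 : cos y1 <> 1) (N2 : cos y2 <> 1) (N3 : cos y3 <> 1) (N4 : cos y4 <> 1).

Lemma cosh_sub_cos_pos y x : cos y <> 1 -> 0 < cosh x - cos y.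
Proof. intros N; pose proof (cosh_ge_1 x); pose proof (COS_bound y); lra. Qed.

Lemma Zre_opp x : Zre p y1 y2 y3 y4 (- x) = - Zre p y1 y2 y3 y4 x.
Proof. unfold Zre; rewrite Ropp_mult_distr_r_reverse, cosh_opp, sinh_opp; ring. Qed.

Lemma Zim_opp x : Zim p y1 y2 y3 y4 (- x) = Zim p y1 y2 y3 y4 x.
Proof. unfold Zim; rewrite Ropp_mult_distr_r_reverse, cosh_opp; ring. Qed.

Lemma ex_derive_Zre x : ex_derive (Zre p y1 y2 y3 y4) x.
Proof.
  unfold Zre; auto_derive.
  repeat split; apply Rgt_not_eq; apply (cosh_sub_cos_pos _ (p * x)); assumption.
Qed.

Lemma ex_derive_Zim x : ex_derive (Zim p y1 y2 y3 y4) x.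
Proof.
  unfold Zim; auto_derive.
  repeat split; apply Rgt_not_eq; apply (cosh_sub_cos_pos _ (p * x)); assumption.
Qed.

(** This serves the convergence of the improper integrals. [Zre] has to be included, because it
    cancels only after the two half-lines have been folded together. *)
Lemma Z_exp_bound : exists K, forall x, 1 <= Rabs x ->
  Rabs (Zre p y1 y2 y3 y4 x) <= K * exp (- (p * Rabs x)) /\
  Rabs (Zim p y1 y2 y3 y4 x) <= K * exp (- (p * Rabs x)).
Proof.
  pose proof (exp_increasing (- p) 0 ltac:(lra)) as Hd; rewrite exp_0 in Hd.
  (* With [E = exp (- p x)], [cosh (p x) - cos y >= (1 - E) ^ 2 / (2 E) >= d / E]. *)
  set (d := (1 - exp (- p)) * (1 - exp (- p)) / 2).
  assert (d0 : 0 < d) by (unfold d; nra).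
  assert (D : forall y x, 1 <= x ->
     Rabs (/ (cosh (p * x) - cos y)) <= / d * exp (- (p * x)) /\ 0 < cosh (p * x) - cos y).
  { intros y x Hx; pose proof (COS_bound y).
    assert (He : exp (- (p * x)) <= exp (- p)).
    { destruct Hx as [Hx|<-]; [left; apply exp_increasing; nra | right; f_equal; ring]. }
    pose proof (exp_pos (- (p * x))) as HE.
    assert (LB : d / exp (- (p * x)) <= cosh (p * x) - cos y).
    { unfold cosh; replace (exp (p * x)) with (/ exp (- (p * x)))
        by (rewrite exp_Ropp; apply Rinv_inv).
      set (E := exp (- (p * x))) in *.
      apply (Rmult_le_reg_r E); [exact HE|].
      replace (d / E * E) with d by (field; lra).
      replace (((/ E + E) / 2 - cos y) * E) with ((1 - 2 * cos y * E + E * E) / 2) by (field; lra).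
      unfold d; nra. }
    assert (P : 0 < d / exp (- (p * x))) by (apply Rdiv_lt_0_compat; lra).
    split; [|lra].
    rewrite Rabs_pos_eq by (left; apply Rinv_0_lt_compat; lra).
    replace (/ d * exp (- (p * x))) with (/ (d / exp (- (p * x)))) by (field; lra).
    now apply Rinv_le_contravar. }
  exists (4 * (/ d * / d) + 4 * / d).
  assert (Hd' : 0 < / d) by now apply Rinv_0_lt_compat.
  assert (main : forall x, 1 <= x ->
    Rabs (Zre p y1 y2 y3 y4 x) <= (4 * (/ d * / d) + 4 * / d) * exp (- (p * x)) /\
    Rabs (Zim p y1 y2 y3 y4 x) <= (4 * (/ d * / d) + 4 * / d) * exp (- (p * x))).
  { intros x Hx; pose proof (exp_pos (- (p * x))) as HE.
    split.
    - assert (Hs : Rabs (sinh (p * x)) * exp (- (p * x)) <= 1).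
      { rewrite <- (Rabs_pos_eq (exp (- (p * x)))), <- Rabs_mult by lra.
        unfold sinh; replace ((exp (p * x) - exp (- (p * x))) / 2 * exp (- (p * x)))
          with ((exp (p * x) * exp (- (p * x)) - exp (- (p * x)) * exp (- (p * x))) / 2) by field.
        rewrite <- exp_plus, Rplus_opp_r, exp_0.
        assert (exp (- (p * x)) < 1) by (rewrite <- exp_0; apply exp_increasing; nra).
        apply Rabs_le; nra. }
      (* The constants at infinity cancel in pairs. *)
      assert (Pair : forall y z, Rabs (sinh (p * x) * (/ (cosh (p * x) - cos y) - / (cosh (p * x) - cos z)))
        <= 2 * (/ d * / d) * exp (- (p * x))).
      { intros y z; destruct (D y x Hx) as [By Py]; destruct (D z x Hx) as [Bz Pz].
        replace (sinh (p * x) * (/ (cosh (p * x) - cos y) - / (cosh (p * x) - cos z)))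
          with ((cos y - cos z) * (sinh (p * x) * (/ (cosh (p * x) - cos y) * / (cosh (p * x) - cos z))))
          by (field; lra).
        rewrite !Rabs_mult.
        apply Rle_trans with (2 * (Rabs (sinh (p * x)) *
          ((/ d * exp (- (p * x))) * (/ d * exp (- (p * x)))))).
        - pose proof (COS_bound y); pose proof (COS_bound z).
          apply Rmult_le_compat; [apply Rabs_pos | | apply Rabs_le; lra |].
          + repeat apply Rmult_le_pos; apply Rabs_pos.
          + apply Rmult_le_compat_l; [apply Rabs_pos|].
            apply Rmult_le_compat; auto using Rabs_pos.
        - replace (2 * (Rabs (sinh (p * x)) * (/ d * exp (- (p * x)) * (/ d * exp (- (p * x))))))
            with (2 * (/ d * / d) * exp (- (p * x)) * (Rabs (sinh (p * x)) * exp (- (p * x)))) by ring.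
          rewrite <- (Rmult_1_r (2 * (/ d * / d) * exp (- (p * x)))) at 2.
          apply Rmult_le_compat_l; [|exact Hs].
          assert (0 < / d * / d) by nra; apply Rmult_le_pos; lra. }
      replace (Zre p y1 y2 y3 y4 x) with
        (sinh (p * x) * (/ (cosh (p * x) - cos y1) - / (cosh (p * x) - cos y3))
         + sinh (p * x) * (/ (cosh (p * x) - cos y2) - / (cosh (p * x) - cos y4)))
        by (unfold Zre; ring).
      eapply Rle_trans; [apply Rabs_triang|].
      pose proof (Pair y1 y3); pose proof (Pair y2 y4).
      assert (0 < / d * exp (- (p * x))) by nra; lra.
    - assert (T : forall y, Rabs (sin y * / (cosh (p * x) - cos y)) <= / d * exp (- (p * x))).
      { intros y; rewrite Rabs_mult, <- (Rmult_1_l (/ d * _)).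
        apply Rmult_le_compat; try apply Rabs_pos; [apply Rabs_le, SIN_bound | apply D, Hx]. }
      pose proof (T y1) as T1; pose proof (T y2) as T2; pose proof (T y3) as T3; pose proof (T y4) as T4.
      apply Rabs_le_between in T1; apply Rabs_le_between in T2;
        apply Rabs_le_between in T3; apply Rabs_le_between in T4.
      assert (0 < / d * / d * exp (- (p * x))) by (apply Rmult_lt_0_compat; nra).
      unfold Zim; apply Rabs_le; lra. }
  intros x Hx; destruct (Rle_dec 0 x) as [Px|Nx].
  - rewrite (Rabs_pos_eq x) in * by exact Px; now apply main.
  - rewrite (Rabs_left x) in * by lra.
    rewrite <- Rabs_Ropp, <- Zre_opp, <- Zim_opp; now apply main.
Qed.

End Kernel.

(** * [Z_N] on the contour: poles, leading coefficient, and the tail form of [R_d] *)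

Lemma Cexp_Ci r : Cexp (Ci * RtoC r) = (cos r, sin r).
Proof.
  unfold Cexp; simpl.
  replace (0 * r - 1 * 0) with 0 by ring; replace (0 * 0 + 1 * r) with r by ring.
  now rewrite exp_0, !Rmult_1_l.
Qed.

(** The imaginary shifts of [H_N] and [Z_N] add up to coth arguments [q (x + i g)]; these are the
    angles [2 q g]. The first two come from [H_N (beta - 5 i pi / 2)], the last two from
    [H_N (beta - i pi / 2)]. A coth has a pole on the contour, at [x = 0], exactly when its angle is
    a multiple of [2 pi]. *)
Definition pole_arg1 phi alpha theta := 2 * q phi * (theta - 2 * PI - alpha).
Definition pole_arg2 phi alpha theta := 2 * q phi * (theta - 4 * PI + alpha).
Definition pole_arg3 phi alpha theta := 2 * q phi * (theta - alpha).
Definition pole_arg4 phi alpha theta := 2 * q phi * (theta - 2 * PI + alpha).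

Definition ZR phi alpha theta : R -> R :=
  Zre (2 * q phi) (pole_arg1 phi alpha theta) (pole_arg2 phi alpha theta)
    (pole_arg3 phi alpha theta) (pole_arg4 phi alpha theta).
Definition ZI phi alpha theta : R -> R :=
  Zim (2 * q phi) (pole_arg1 phi alpha theta) (pole_arg2 phi alpha theta)
    (pole_arg3 phi alpha theta) (pole_arg4 phi alpha theta).

(* No pole of the integrand lies on the contour. *)
Definition regular phi alpha theta : Prop :=
  cos (pole_arg1 phi alpha theta) <> 1 /\ cos (pole_arg2 phi alpha theta) <> 1 /\
  cos (pole_arg3 phi alpha theta) <> 1 /\ cos (pole_arg4 phi alpha theta) <> 1.

Lemma Z_N_re_im phi alpha theta x : regular phi alpha theta ->
  Z_N phi alpha (RtoC x + Ci * RtoC theta) = (ZR phi alpha theta x, ZI phi alpha theta x).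
Proof.
  intros [N1 [N2 [N3 N4]]].
  assert (T : forall (z : C) g, cos (2 * q phi * g) <> 1 ->
    z = (q phi * x, q phi * g) ->
    Ccoth z = (sinh (2 * q phi * x) * / (cosh (2 * q phi * x) - cos (2 * q phi * g)),
               - (sin (2 * q phi * g) * / (cosh (2 * q phi * x) - cos (2 * q phi * g))))).
  { intros z g N ->; pose proof (cosh_sub_cos_pos _ (2 * q phi * x) N).
    rewrite !Rmult_assoc in *; apply Ccoth_re_im; lra. }
  unfold Z_N, H_N.
  rewrite (T _ (theta - 2 * PI - alpha) N1), (T _ (theta - 4 * PI + alpha) N2),
    (T _ (theta - alpha) N3), (T _ (theta - 2 * PI + alpha) N4).
  - unfold ZR, ZI, Zre, Zim, pole_arg1, pole_arg2, pole_arg3, pole_arg4.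
    apply injective_projections; simpl; ring.
  - apply injective_projections; simpl; field.
  - apply injective_projections; simpl; field.
  - apply injective_projections; simpl; field.
  - apply injective_projections; simpl; field.
Qed.

Lemma cos_eq_1 y : cos y = 1 -> exists k : Z, y = 2 * IZR k * PI.
Proof.
  intros H; assert (S : sin (y / 2) = 0).
  { replace y with (2 * (y / 2)) in H by field; rewrite cos_2a_sin in H; nra. }
  destruct (sin_eq_0_0 _ S) as [k Hk]; exists k; lra.
Qed.

(** A pole requires [g = 2 k PHI] for an integer [k]. The ranges of [theta] and [alpha] confine the
    four [g] so far that the first and third admit no [k], the second only [k = -1], which is
    [theta = theta1], and the fourth only [k = 0], which is [theta = theta2]. *)
Lemma in_Theta_regular phi alpha theta : 0 < phi < PI ->
  Rmax (phi - PI / 2) 0 < alpha < Rmin (PI / 2) phi ->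
  in_Theta phi alpha theta -> regular phi alpha theta.
Proof.
  intros Hphi [Ha1 Ha2] [Ht [H1 H2]]; unfold theta1, theta2 in *.
  pose proof (Rmax_l (phi - PI / 2) 0); pose proof (Rmax_r (phi - PI / 2) 0).
  pose proof (Rmin_l (PI / 2) phi); pose proof (Rmin_r (PI / 2) phi).
  pose proof PI_RGT_0 as HPI.
  assert (N : forall g, cos (2 * q phi * g) = 1 -> exists k : Z, g = 2 * IZR k * PHI phi).
  { intros g Hg; destruct (cos_eq_1 _ Hg) as [k Hk]; exists k.
    unfold q, PHI in *.
    assert (E : g * (PI / (2 * PI - phi)) = 2 * IZR k * (2 * PI - phi) * (PI / (2 * PI - phi)))
      by (field_simplify; [field_simplify in Hk|..]; lra).
    apply Rmult_eq_reg_r in E; [exact E|].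
    apply Rgt_not_eq, Rdiv_lt_0_compat; lra. }
  assert (Z : forall g k m, g = 2 * IZR k * PHI phi ->
    2 * IZR m * PHI phi < g -> (m < k)%Z).
  { intros g k m -> Hm; apply lt_IZR; unfold PHI in *; nra. }
  assert (Z' : forall g k m, g = 2 * IZR k * PHI phi ->
    g < 2 * IZR m * PHI phi -> (k < m)%Z).
  { intros g k m -> Hm; apply lt_IZR; unfold PHI in *; nra. }
  unfold regular, pole_arg1, pole_arg2, pole_arg3, pole_arg4; repeat split; intros E;
    destruct (N _ E) as [k Hk].
  - assert (-1 < k)%Z by (apply (Z _ _ _ Hk); unfold PHI; lra).
    assert (k < 0)%Z by (apply (Z' _ _ _ Hk); unfold PHI; lra); lia.
  - assert (-2 < k)%Z by (apply (Z _ _ _ Hk); unfold PHI; lra).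
    assert (k < 0)%Z by (apply (Z' _ _ _ Hk); unfold PHI; lra).
    replace k with (-1)%Z in Hk by lia; unfold PHI in Hk; lra.
  - assert (0 < k)%Z by (apply (Z _ _ _ Hk); unfold PHI; lra).
    assert (k < 1)%Z by (apply (Z' _ _ _ Hk); unfold PHI; lra); lia.
  - assert (-1 < k)%Z by (apply (Z _ _ _ Hk); unfold PHI; lra).
    assert (k < 1)%Z by (apply (Z' _ _ _ Hk); unfold PHI; lra).
    replace k with 0%Z in Hk by lia; unfold PHI in Hk; lra.
Qed.

(** The two shifts of [H_N] differ by [2 pi i], that is by [2 w] in the angles. Hence the sines pair
    up as [sin (a + w) - sin (a - w) = 2 cos a sin w] with [a = v - u] and [a = - (u + v)], and [cos
    (v - u) + cos (u + v) = 2 cos u cos v]. *)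
Lemma leading_coefficient phi alpha theta : 0 < phi < PI ->
  4 * (sin (pole_arg3 phi alpha theta) + sin (pole_arg4 phi alpha theta)
       - sin (pole_arg1 phi alpha theta) - sin (pole_arg2 phi alpha theta))
  = b1 phi * z1 phi alpha theta.
Proof.
  intros Hphi; unfold b1, z1.
  assert (HP : 0 < PHI phi) by (unfold PHI; lra).
  set (u := PI / PHI phi * (2 * PI - theta)); set (v := PI / PHI phi * (PI - alpha)).
  set (w := PI ^ 2 / PHI phi).
  replace (pole_arg1 phi alpha theta) with (v - u - w)
    by (unfold pole_arg1, u, v, w, q; field; lra).
  replace (pole_arg2 phi alpha theta) with (- u - v - w)
    by (unfold pole_arg2, u, v, w, q; field; lra).
  replace (pole_arg3 phi alpha theta) with (v - u + w)
    by (unfold pole_arg3, u, v, w, q; field; lra).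
  replace (pole_arg4 phi alpha theta) with (- u - v + w)
    by (unfold pole_arg4, u, v, w, q; field; lra).
  replace (- u - v) with (- (u + v)) by ring.
  rewrite (sin_plus (v - u)), (sin_minus (v - u)), (sin_plus (- (u + v))), (sin_minus (- (u + v))).
  rewrite cos_neg, cos_minus, cos_plus; ring.
Qed.

Lemma R_d_tail_integrals omega0 phi alpha rho theta t B : 0 < phi < PI ->
  regular phi alpha theta -> 0 < rho -> 0 < B -> t = rho * cosh B ->
  exists Ic Is : R,
    is_lim (fun b => RInt (fun x => cos (omega0 * (rho * cosh x - t)) * (2 * ZI phi alpha theta x)) B b)
      p_infty Ic /\
    is_lim (fun b => RInt (fun x => sin (omega0 * (rho * cosh x - t)) * (2 * ZI phi alpha theta x)) B b)
      p_infty Is /\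
    (Cexp (- (Ci * RtoC (omega0 * t))) * R_d omega0 phi alpha heaviside rho theta t)%C
      = (- Ic / (4 * PHI phi), - Is / (4 * PHI phi)).
Proof.
  intros Hphi Hreg Hr HB Ht.
  pose proof PI_RGT_0 as HPI.
  assert (Hp : 0 < 2 * q phi) by (unfold q, PHI; apply Rmult_lt_0_compat; [lra|]; apply Rdiv_lt_0_compat; lra).
  pose proof Hreg as [N1 [N2 [N3 N4]]].
  set (Zr := ZR phi alpha theta); set (Zi := ZI phi alpha theta).
  set (Y := fun x => omega0 * rho * cosh x).
  set (fr := fun x => cos (Y x) * Zr x - sin (Y x) * Zi x).
  set (fi := fun x => cos (Y x) * Zi x + sin (Y x) * Zr x).
  set (s := fun x => heaviside (t - rho * cosh x)).
  assert (EA : A_d omega0 phi alpha rho theta = (Ci / RtoC (4 * PHI phi) *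
    (RInt_gen fr (Rbar_locally m_infty) (Rbar_locally p_infty),
     RInt_gen fi (Rbar_locally m_infty) (Rbar_locally p_infty)))%C).
  { unfold A_d, CRInt_line; f_equal; apply f_equal2; f_equal; apply functional_extensionality; intros x;
      rewrite Cexp_Ci, Z_N_re_im by exact Hreg; reflexivity. }
  assert (EAt : A_d_t omega0 phi alpha heaviside rho theta t = (Ci / RtoC (4 * PHI phi) *
    (RInt_gen (fun x => (s x * fr x)%R) (Rbar_locally m_infty) (Rbar_locally p_infty),
     RInt_gen (fun x => (s x * fi x)%R) (Rbar_locally m_infty) (Rbar_locally p_infty)))%C).
  { unfold A_d_t, CRInt_line; f_equal; apply f_equal2; f_equal; apply functional_extensionality; intros x;
      rewrite Cexp_Ci, Z_N_re_im by exact Hreg; simpl; unfold fr, fi, s, Y, Zr, Zi; ring. }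
  assert (ER : forall x, ex_derive Zr x) by (intros; now apply ex_derive_Zre).
  assert (EI : forall x, ex_derive Zi x) by (intros; now apply ex_derive_Zim).
  assert (Cr : forall x, continuous fr x).
  { intros x; apply (ex_derive_continuous fr); unfold fr, Y; auto_derive.
    repeat split; auto. }
  assert (Ci' : forall x, continuous fi x).
  { intros x; apply (ex_derive_continuous fi); unfold fi, Y; auto_derive.
    repeat split; auto. }
  destruct (Z_exp_bound _ (pole_arg1 phi alpha theta) (pole_arg2 phi alpha theta)
    (pole_arg3 phi alpha theta) (pole_arg4 phi alpha theta) Hp) as [K HK].
  (* [a] and [b] are fixed only up to sign, so that one bound covers both [fr] and [fi]. *)
  assert (Bd : forall u v a b, Rabs u <= 1 -> Rabs v <= 1 ->
     forall x, 1 <= Rabs x -> Rabs a = Rabs (Zr x) -> Rabs b = Rabs (Zi x) ->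
     Rabs (u * a + v * b) <= (2 * K) * exp (- (2 * q phi * Rabs x))).
  { intros u v a b Hu Hv x Hx Ea Eb; destruct (HK x Hx) as [B1 B2].
    change (Rabs (Zr x) <= K * exp (- (2 * q phi * Rabs x))) in B1.
    change (Rabs (Zi x) <= K * exp (- (2 * q phi * Rabs x))) in B2.
    eapply Rle_trans; [apply Rabs_triang|]; rewrite !Rabs_mult, Ea, Eb.
    pose proof (Rabs_pos (Zr x)); pose proof (Rabs_pos (Zi x)).
    pose proof (Rabs_pos u); pose proof (Rabs_pos v); nra. }
  assert (TC : forall x, Rabs (cos x) <= 1) by (intros; apply Rabs_le, COS_bound).
  assert (TS : forall x, Rabs (sin x) <= 1) by (intros; apply Rabs_le, SIN_bound).
  assert (S1 : forall f x, Rabs x < B -> s x * f x = f x).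
  { intros f x Hx; unfold s, heaviside; pose proof (cosh_lt _ _ Hx).
    destruct Rlt_dec; [|ring]; rewrite Ht in *; nra. }
  assert (S0 : forall f x, B < Rabs x -> s x * f x = 0).
  { intros f x Hx; unfold s, heaviside.
    assert (cosh B < cosh x) by (rewrite <- (cosh_Rabs x); apply cosh_lt; rewrite Rabs_pos_eq; lra).
    destruct Rlt_dec; [ring|]; rewrite Ht in *; nra. }
  pose proof (RInt_gen_tail fr (fun x => s x * fr x) B (2 * K) _ Hp HB Cr) as Lr.
  pose proof (RInt_gen_tail fi (fun x => s x * fi x) B (2 * K) _ Hp HB Ci') as Li.
  unfold R_d; rewrite EA, EAt; clear EA EAt.
  set (Fr := RInt_gen fr _ _) in *; set (Gr := RInt_gen (fun x => s x * fr x) _ _) in *.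
  set (Fi := RInt_gen fi _ _) in *; set (Gi := RInt_gen (fun x => s x * fi x) _ _) in *.
  specialize (Lr ltac:(intros x Hx; unfold fr, Rminus; rewrite Ropp_mult_distr_r;
    apply Bd; auto; apply Rabs_Ropp) (S1 fr) (S0 fr)).
  specialize (Li ltac:(intros x Hx; unfold fi; rewrite Rplus_comm;
    apply Bd; auto) (S1 fi) (S0 fi)).
  apply (is_lim_ext _ (fun b => RInt (fun x => - (sin (Y x) * (2 * Zi x))) B b)) in Lr.
  2:{ intros b; apply RInt_ext; intros x _; unfold fr, Y, Zr, Zi, ZR, ZI.
      rewrite cosh_opp, Zre_opp, Zim_opp; simpl; ring. }
  apply (is_lim_ext _ (fun b => RInt (fun x => cos (Y x) * (2 * Zi x)) B b)) in Li.
  2:{ intros b; apply RInt_ext; intros x _; unfold fi, Y, Zr, Zi, ZR, ZI.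
      rewrite cosh_opp, Zre_opp, Zim_opp; simpl; ring. }
  set (w := omega0 * t).
  assert (Ir : forall b, ex_RInt (fun x => - (sin (Y x) * (2 * Zi x))) B b).
  { intros b; apply (ex_RInt_continuous (V := R_CompleteNormedModule)); intros x _.
    apply (ex_derive_continuous (fun x => - (sin (Y x) * (2 * Zi x)))); unfold Y; auto_derive.
    repeat split; auto. }
  assert (Ii : forall b, ex_RInt (fun x => cos (Y x) * (2 * Zi x)) B b).
  { intros b; apply (ex_RInt_continuous (V := R_CompleteNormedModule)); intros x _.
    apply (ex_derive_continuous (fun x => cos (Y x) * (2 * Zi x))); unfold Y; auto_derive.
    repeat split; auto. }
  (* Rotating by [exp (- i w)] only mixes the two tails linearly, by the addition formulas for
     [Y - w]. Existence of the limits [Ic] and [Is] follows without a new convergence argument. *)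
  assert (Comb : forall c d, is_lim (fun b => RInt (fun x =>
      c * - (sin (Y x) * (2 * Zi x)) + d * (cos (Y x) * (2 * Zi x))) B b) p_infty
      (c * (Fr - Gr) + d * (Fi - Gi))).
  { intros c d.
    apply (is_lim_ext (fun b => c * RInt (fun x => - (sin (Y x) * (2 * Zi x))) B b
      + d * RInt (fun x => cos (Y x) * (2 * Zi x)) B b)).
    - intros b; symmetry; apply is_RInt_unique.
      apply (is_RInt_plus (fun x => c * - (sin (Y x) * (2 * Zi x)))
        (fun x => d * (cos (Y x) * (2 * Zi x)))).
      + apply (is_RInt_scal (fun x => - (sin (Y x) * (2 * Zi x))) B b c).
        apply (RInt_correct (fun x => - (sin (Y x) * (2 * Zi x)))), Ir.
      + apply (is_RInt_scal (fun x => cos (Y x) * (2 * Zi x)) B b d).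
        apply (RInt_correct (fun x => cos (Y x) * (2 * Zi x))), Ii.
    - apply is_lim_plus'.
      + apply (is_lim_scal_l _ c p_infty (Finite (Fr - Gr))), Lr.
      + apply (is_lim_scal_l _ d p_infty (Finite (Fi - Gi))), Li. }
  assert (EY : forall x, omega0 * (rho * cosh x - t) = Y x - w) by (intros; unfold Y, w; ring).
  exists (- sin w * (Fr - Gr) + cos w * (Fi - Gi)), (- cos w * (Fr - Gr) + - sin w * (Fi - Gi)).
  split; [|split].
  - eapply is_lim_ext; [|apply Comb].
    intros b; apply RInt_ext; intros x _; rewrite EY, cos_minus; fold Zi; simpl; ring.
  - eapply is_lim_ext; [|apply Comb].
    intros b; apply RInt_ext; intros x _; rewrite EY, sin_minus; fold Zi; simpl; ring.
  - assert (HP : PHI phi <> 0) by (unfold PHI; lra).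
    fold w; replace (- (Ci * RtoC w))%C with (Ci * RtoC (- w))%C
      by (apply injective_projections; simpl; ring).
    rewrite Cexp_Ci, cos_neg, sin_neg.
    apply injective_projections; simpl; field; exact HP.
Qed.
(** * The asymptotic expansion *)

Lemma exp_sub_1_bound u : 0 <= u -> 0 <= 1 - exp (- u) <= u.
Proof.
  intros Hu; pose proof (exp_ineq1_le (- u)); split; [|lra].
  destruct Hu as [Hu|<-]; [|rewrite Ropp_0, exp_0; lra].
  pose proof (exp_increasing (- u) 0 ltac:(lra)) as H1; rewrite exp_0 in H1; lra.
Qed.

(** With [z = exp (- 2 B)] one has exactly [t = (rho / 2) exp B (1 + z)]. For [a = p + m] the two
    terms thus differ by the factor [(1 + z) ^ - a], and [0 <= 1 - (1 + z) ^ - a <= a z]. *)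
Lemma leading_power_expansion rho t B p m : 0 < rho -> t = rho * cosh B -> 0 <= p ->
  Rabs (rho ^ m * (Rpower (rho / 2) p * Rpower t (- (p + INR m)))
        - 2 ^ m * exp (- ((p + INR m) * B)))
  <= 2 ^ m * (p + INR m) * exp (- ((p + INR m + 2) * B)).
Proof.
  intros Hr -> Hp; pose proof (pos_INR m) as Hm.
  pose proof (exp_pos (- (2 * B))) as Hz; set (z := exp (- (2 * B))) in *.
  set (a := p + INR m) in *.
  assert (EC : ln (cosh B) = B + ln (1 + z) - ln 2).
  { replace (cosh B) with (exp B * ((1 + z) / 2)).
    - rewrite ln_mult, ln_exp, ln_div by (try apply exp_pos; lra); ring.
    - unfold cosh, z; replace (- (2 * B)) with (- B + - B) by ring.
      rewrite exp_plus; assert (exp B * exp (- B) = 1)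
        by (rewrite <- exp_plus, Rplus_opp_r; apply exp_0).
      replace (exp B * ((1 + exp (- B) * exp (- B)) / 2))
        with ((exp B + exp B * exp (- B) * exp (- B)) / 2) by field.
      rewrite H, Rmult_1_l; reflexivity. }
  assert (PW : forall x, 0 < x -> x ^ m = exp (INR m * ln x))
    by (intros x Hx; rewrite <- Rpower_pow by exact Hx; reflexivity).
  assert (E : rho ^ m * (Rpower (rho / 2) p * Rpower (rho * cosh B) (- a))
     = 2 ^ m * exp (- (a * B)) * exp (- (a * ln (1 + z)))).
  { rewrite !PW by lra; unfold Rpower; rewrite <- !exp_plus; f_equal.
    rewrite ln_mult, EC, ln_div by (try lra; pose proof (cosh_ge_1 B); lra).
    unfold a; ring. }
  rewrite E.
  assert (L0 : 0 <= ln (1 + z)) by (rewrite <- ln_1; apply ln_le; lra).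
  assert (L1 : ln (1 + z) <= z).
  { rewrite <- (ln_exp z) at 2; apply ln_le; [lra | apply exp_ineq1_le]. }
  destruct (exp_sub_1_bound (a * ln (1 + z))) as [U1 U2]; [unfold a; nra|].
  replace (2 ^ m * exp (- (a * B)) * exp (- (a * ln (1 + z))) - 2 ^ m * exp (- (a * B)))
    with (- (2 ^ m * exp (- (a * B)) * (1 - exp (- (a * ln (1 + z)))))) by ring.
  assert (P : 0 < 2 ^ m * exp (- (a * B))).
  { apply Rmult_lt_0_compat; [apply pow_lt; lra | apply exp_pos]. }
  rewrite Rabs_Ropp, Rabs_pos_eq by (apply Rmult_le_pos; lra).
  replace (2 ^ m * a * exp (- ((a + 2) * B))) with (2 ^ m * exp (- (a * B)) * (a * z)).
  - apply Rmult_le_compat_l; [lra|]; eapply Rle_trans; [exact U2|].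
    apply Rmult_le_compat_l; [unfold a; lra | exact L1].
  - unfold z; replace (- ((a + 2) * B)) with (- (a * B) + - (2 * B)) by ring.
    rewrite exp_plus; ring.
Qed.

(** This absorbs the [rho ^ - m] left by the integrations by parts. From [cosh B <= exp B] comes
    [exp (- B) <= rho / t]; the condition [m <= b] leaves a nonnegative power of [rho], and [t >= 1]
    allows [b] to be lowered to [b']. *)
Lemma remainder_scaling rho0 rho t B b b' m : 0 < rho <= rho0 -> t = rho * cosh B ->
  0 <= B -> 1 <= t -> INR m <= b -> 0 <= b -> b' <= b ->
  exp (- (b * B)) / rho ^ m <= Rpower rho0 (b - INR m) * Rpower t (- b').
Proof.
  intros [Hr Hr0] Ht HB H1 Hm Hb Hb'.
  assert (HL : ln t - ln rho <= B).
  { rewrite Ht, ln_mult by (try lra; pose proof (cosh_ge_1 B); lra).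
    assert (ln (cosh B) <= B); [|lra].
    rewrite <- (ln_exp B) at 2; apply ln_le; [pose proof (cosh_ge_1 B); lra|].
    unfold cosh; assert (exp (- B) <= exp B); [|lra].
    destruct HB as [HB|<-]; [left; apply exp_increasing; lra | right; f_equal; ring]. }
  assert (Lt : 0 <= ln t) by (rewrite <- ln_1; apply ln_le; lra).
  assert (Lr : ln rho <= ln rho0) by (apply ln_le; lra).
  rewrite <- (Rpower_pow m rho Hr); unfold Rpower, Rdiv; rewrite <- exp_Ropp, <- !exp_plus.
  apply exp_le; nra.
Qed.

Lemma arcosh_exists y : cosh 1 < y -> exists B, 1 < B /\ cosh B = y.
Proof.
  intros Hy; pose proof (cosh_ge_1 1).
  set (B := arcsinh (sqrt (y * y - 1))); exists B.
  assert (HB : cosh B = y).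
  { pose proof (cosh_sqr B) as E; unfold B in E at 3 4; rewrite sinh_arcsinh, sqrt_sqrt in E by nra.
    pose proof (cosh_ge_1 B); nra. }
  split; [|exact HB].
  apply Rnot_le_lt; intros Hle.
  assert (P : 0 < B).
  { rewrite <- arcsinh_0; apply arcsinh_lt, sqrt_lt_R0; nra. }
  destruct Hle as [Hlt|E1]; [|rewrite E1 in HB; lra].
  pose proof (cosh_lt B 1 ltac:(rewrite Rabs_pos_eq; lra)); lra.
Qed.

Lemma tail_integral_asymptotics omega0 phi alpha rho0 : 0 < omega0 -> 0 < phi < PI -> 0 < rho0 ->
  exists M T, 0 < T /\ forall rho theta t B (Ic Is : R), 0 < rho <= rho0 -> T <= t ->
    1 < B -> t = rho * cosh B ->
    is_lim (fun b => RInt (fun x => cos (omega0 * (rho * cosh x - t)) * (2 * ZI phi alpha theta x)) B b)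
      p_infty Ic ->
    is_lim (fun b => RInt (fun x => sin (omega0 * (rho * cosh x - t)) * (2 * ZI phi alpha theta x)) B b)
      p_infty Is ->
    Rabs (Ic - b1 phi * z1 phi alpha theta * (2 * q phi + 1) / omega0 ^ 2
            * (Rpower (rho / 2) (2 * q phi) * Rpower t (- (2 * q phi + 2))))
      <= M * Rpower t (- (4 * q phi + 2)) /\
    Rabs (Is - b1 phi * z1 phi alpha theta / omega0
            * (Rpower (rho / 2) (2 * q phi) * Rpower t (- (2 * q phi + 1))))
      <= M * Rpower t (- (4 * q phi + 1)).
Proof.
  intros Hw Hphi Hr0; pose proof PI_RGT_0 as HPI.
  assert (Hp : 0 < 2 * q phi <= 1).
  { unfold q, PHI; split; [apply Rmult_lt_0_compat; [lra|]; apply Rdiv_lt_0_compat; lra|].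
    replace (2 * (PI / (2 * (2 * PI - phi)))) with (PI / (2 * PI - phi)) by (field; lra).
    apply Rle_div_l; lra. }
  set (p := 2 * q phi) in *.
  set (c := fun theta => b1 phi * z1 phi alpha theta).
  (* The coefficient is 4 times a signed sum of four sines. *)
  assert (Hc : forall theta, Rabs (c theta) <= 16).
  { intros theta; unfold c; rewrite <- leading_coefficient by exact Hphi.
    pose proof (SIN_bound (pole_arg1 phi alpha theta)); pose proof (SIN_bound (pole_arg2 phi alpha theta)).
    pose proof (SIN_bound (pole_arg3 phi alpha theta)); pose proof (SIN_bound (pole_arg4 phi alpha theta)).
    apply Rabs_le; lra. }
  (* The family is indexed by [theta] itself, ranging over all reals, so [K] cannot depend on
     [theta]. *)
  destruct (iterated_division_by_sinh p c 16 (fun theta x => 2 * ZI phi alpha theta x) Hp Hc)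
    as [k0 [k1 [k2 [k3 [HD [K [HK HB]]]]]]].
  { eapply symb_ext; [|apply (symb_Zim 4 p (pole_arg1 phi alpha) (pole_arg2 phi alpha)
      (pole_arg3 phi alpha) (pole_arg4 phi alpha)); lra].
    intros theta x _; simpl; rewrite leading_coefficient by exact Hphi; reflexivity. }
  assert (L0 : forall theta, is_lim (k0 theta) p_infty 0).
  { intros theta.
    apply (is_lim_ext (fun x => (k0 theta x - 2 * c theta * exp (- ((p + 1) * x)))
      + 2 * c theta * exp (- ((p + 1) * x)))); [intros; ring|].
    replace (Finite 0) with (Finite (0 + 0)) by (f_equal; ring); apply is_lim_plus'.
    - apply (is_lim_of_exp_bound _ K (2 * p + 1) 1); [lra|]; intros x Hx; apply HB, Hx.
    - apply is_lim_exp_neg; lra. }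
  assert (L1 : forall theta, is_lim (k1 theta) p_infty 0).
  { intros theta.
    apply (is_lim_ext (fun x => (k1 theta x + 4 * (p + 1) * c theta * exp (- ((p + 2) * x)))
      + (- (4 * (p + 1) * c theta)) * exp (- ((p + 2) * x)))); [intros; ring|].
    replace (Finite 0) with (Finite (0 + 0)) by (f_equal; ring); apply is_lim_plus'.
    - apply (is_lim_of_exp_bound _ K (2 * p + 2) 1); [lra|]; intros x Hx; apply HB, Hx.
    - apply is_lim_exp_neg; lra. }
  assert (L2 : forall theta, is_lim (k2 theta) p_infty 0).
  { intros theta; apply (is_lim_of_exp_bound _ K (p + 3) 1); [lra|]; intros x Hx; apply HB, Hx. }
  (* In [Mc] and [Ms] the first summand bounds the remainder integral. The second bounds the
     boundary value against its leading power of [t]: [K] from the expansion of the kernel, the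
     other term from [leading_power_expansion], with 16 bounding [c]. *)
  set (Mc := K / omega0 ^ 3 / (p + 3) * Rpower rho0 (p + 3 - INR 3)
     + (K + 16 * (p + 1) * (4 * (p + 2))) / omega0 ^ 2 * Rpower rho0 (2 * p + 2 - INR 2)).
  set (Ms := K / omega0 ^ 2 / (p + 2) * Rpower rho0 (p + 2 - INR 2)
     + (K + 16 * (2 * (p + 1))) / omega0 * Rpower rho0 (2 * p + 1 - INR 1)).
  exists (Rmax Mc Ms), 1; split; [lra|].
  intros rho theta t B Ic Is Hr Ht HB1 Et HIc HIs.
  assert (W2 : 0 < omega0 ^ 2) by (apply pow_lt; lra).
  assert (W3 : 0 < omega0 ^ 3) by (apply pow_lt; lra).
  assert (R2 : 0 < rho ^ 2) by (apply pow_lt; lra).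
  assert (R3 : 0 < rho ^ 3) by (apply pow_lt; lra).
  assert (WR : 0 < omega0 * rho) by nra.
  destruct (HB theta B HB1) as [B0 [B1 _]].
  assert (EH : forall (u : R -> R) l,
    is_lim (fun b => RInt (fun x => u x * (2 * ZI phi alpha theta x)) B b) p_infty l ->
    is_lim (fun b => RInt (fun x => u x * (k0 theta x * sinh x)) B b) p_infty l).
  { intros u l; apply is_lim_ext_loc; exists B; intros b Hb.
    apply RInt_ext; intros x; rewrite Rmin_left by lra; intros Hx.
    destruct (HD theta x ltac:(lra)) as [<- _]; reflexivity. }
  apply EH in HIc; apply EH in HIs.
  assert (Pt : forall x, 0 < Rpower t x) by (intros; apply exp_pos).
  assert (Fin : forall X M M' b, M <= M' -> X <= M * Rpower t b -> X <= M' * Rpower t b).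
  { intros X M M' b HM HX; eapply Rle_trans; [exact HX|].
    apply Rmult_le_compat_r; [left; apply Pt | exact HM]. }
  specialize (Hc theta).
  assert (Rem : forall m b b' L, 0 <= L -> INR m <= b -> 0 <= b -> b' <= b ->
    L * (exp (- (b * B)) / rho ^ m) <= L * Rpower rho0 (b - INR m) * Rpower t (- b')).
  { intros m b b' L HL Hm Hb Hb'; rewrite Rmult_assoc; apply Rmult_le_compat_l; [exact HL|].
    apply (remainder_scaling rho0 rho t B); auto; lra. }
  replace (4 * q phi) with (2 * p) by (unfold p; ring).
  assert (I1 : INR 1 = 1) by reflexivity.
  assert (I2 : INR 2 = 2) by (simpl; ring).
  assert (I3 : INR 3 = 3) by (simpl; ring).
  assert (EE : forall a b, b <= a -> exp (- (a * B)) <= exp (- (b * B))) by (intros; apply exp_le; nra).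
  split.
  - apply (Fin _ Mc); [apply Rmax_l|].
    pose proof (cosine_integral_estimate (k0 theta) (k1 theta) (k2 theta) (k3 theta)
      omega0 rho t B (p + 3) K Hw (proj1 Hr) HB1 ltac:(lra) HK Et
      ltac:(apply HD) ltac:(apply HD) ltac:(apply HD) ltac:(apply HD)
      (L0 theta) (L1 theta) (L2 theta) Ic ltac:(apply HB) HIc) as E1.
    pose proof (leading_power_expansion rho t B p 2 (proj1 Hr) Et ltac:(lra)) as E2.
    rewrite I2 in E2.
    set (Lp := Rpower (rho / 2) p * Rpower t (- (p + 2))) in *.
    (* Two comparisons are inserted: [k1 B] with its leading exponential, and that exponential with
       [rho ^ 2 * Lp], whose [rho ^ 2] cancels the one in the denominator. *)
    replace (Ic - b1 phi * z1 phi alpha theta * (p + 1) / omega0 ^ 2 * Lp) with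
      ((Ic + k1 theta B / (omega0 * rho) ^ 2)
       - ((k1 theta B + 4 * (p + 1) * c theta * exp (- ((p + 2) * B)))
          + c theta * (p + 1) * (rho ^ 2 * Lp - 2 ^ 2 * exp (- ((p + 2) * B)))) / (omega0 * rho) ^ 2)
      by (unfold c; field; lra).
    eapply Rle_trans; [apply Rabs_triang|]; rewrite Rabs_Ropp.
    unfold Mc; rewrite (Rmult_plus_distr_r _ _ (Rpower t _)); apply Rplus_le_compat.
    + eapply Rle_trans; [exact E1|].
      (* Here [p <= 1] is decisive: the remainder has rate [p + 3], and [2 p + 2] is wanted. The
         sine case compares [p + 2] with [2 p + 1] in the same way. *)
      eapply Rle_trans; [|apply Rem; try lra].
      * right; field; lra.
      * apply Rdiv_le_0_compat; [|lra]; apply Rdiv_le_0_compat; lra.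
    + eapply Rle_trans; [|apply Rem; try lra].
      2:{ apply Rdiv_le_0_compat; [|lra]; nra. }
      unfold Rdiv at 1; rewrite Rabs_mult, (Rabs_pos_eq (/ _))
        by (left; apply Rinv_0_lt_compat, pow_lt, WR).
      replace ((K + 16 * (p + 1) * (4 * (p + 2))) / omega0 ^ 2 * (exp (- ((2 * p + 2) * B)) / rho ^ 2))
        with (((K + 16 * (p + 1) * (4 * (p + 2))) * exp (- ((2 * p + 2) * B))) * / (omega0 * rho) ^ 2)
        by (field; lra).
      apply Rmult_le_compat_r; [left; apply Rinv_0_lt_compat, pow_lt, WR|].
      eapply Rle_trans; [apply Rabs_triang|].
      rewrite (Rmult_plus_distr_r K); apply Rplus_le_compat; [exact B1|].
      rewrite !Rabs_mult, (Rabs_pos_eq (p + 1)), Rmult_assoc by lra.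
      rewrite (Rmult_assoc 16 (p + 1)), (Rmult_assoc 16).
      apply Rmult_le_compat; [apply Rabs_pos | | exact Hc |].
      { apply Rmult_le_pos; [lra | apply Rabs_pos]. }
      rewrite Rmult_assoc; apply Rmult_le_compat_l; [lra|].
      eapply Rle_trans; [exact E2|].
      replace (2 ^ 2 * (p + 2)) with (4 * (p + 2)) by ring.
      apply Rmult_le_compat_l; [lra|]; apply EE; lra.
  - apply (Fin _ Ms); [apply Rmax_r|].
    pose proof (sine_integral_estimate (k0 theta) (k1 theta) (k2 theta) (k3 theta)
      omega0 rho t B (p + 2) K Hw (proj1 Hr) HB1 ltac:(lra) HK Et
      ltac:(apply HD) ltac:(apply HD) ltac:(apply HD)
      (L0 theta) (L1 theta) Is ltac:(apply HB) HIs) as E1.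
    pose proof (leading_power_expansion rho t B p 1 (proj1 Hr) Et ltac:(lra)) as E2.
    rewrite I1, !pow_1 in E2.
    set (Lp := Rpower (rho / 2) p * Rpower t (- (p + 1))) in *.
    replace (Is - b1 phi * z1 phi alpha theta / omega0 * Lp) with
      ((Is - k0 theta B / (omega0 * rho))
       + ((k0 theta B - 2 * c theta * exp (- ((p + 1) * B)))
          - c theta * (rho * Lp - 2 * exp (- ((p + 1) * B)))) / (omega0 * rho))
      by (unfold c; field; lra).
    eapply Rle_trans; [apply Rabs_triang|].
    unfold Ms; rewrite (Rmult_plus_distr_r _ _ (Rpower t _)); apply Rplus_le_compat.
    + eapply Rle_trans; [exact E1|].
      eapply Rle_trans; [|apply Rem; try lra].
      * right; field; lra.
      * apply Rdiv_le_0_compat; [|lra]; apply Rdiv_le_0_compat; lra.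
    + eapply Rle_trans; [|apply Rem; try lra].
      2:{ apply Rdiv_le_0_compat; [|lra]; nra. }
      unfold Rdiv at 1; rewrite Rabs_mult, (Rabs_pos_eq (/ _))
        by (left; apply Rinv_0_lt_compat, WR).
      replace ((K + 16 * (2 * (p + 1))) / omega0 * (exp (- ((2 * p + 1) * B)) / rho ^ 1))
        with (((K + 16 * (2 * (p + 1))) * exp (- ((2 * p + 1) * B))) * / (omega0 * rho))
        by (field; lra).
      apply Rmult_le_compat_r; [left; apply Rinv_0_lt_compat, WR|].
      eapply Rle_trans; [apply Rabs_triang|]; rewrite Rabs_Ropp.
      rewrite (Rmult_plus_distr_r K); apply Rplus_le_compat; [exact B0|].
      rewrite Rabs_mult, Rmult_assoc.
      apply Rmult_le_compat; [apply Rabs_pos | apply Rabs_pos | exact Hc |].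
      eapply Rle_trans; [exact E2|].
      apply Rmult_le_compat_l; [lra|]; apply EE; lra.
Qed.

Theorem theorem8p3 (omega0 phi alpha : R)
  (Homega0 : 0 < omega0)
  (Hphi : 0 < phi < PI)
  (Halpha : Rmax (phi - PI / 2) 0 < alpha < Rmin (PI / 2) phi)
  (rho0 : R) (Hrho0 : 0 < rho0) :
  (exists M T : R, 0 < T /\
     forall rho theta t : R,
       0 < rho <= rho0 -> in_Theta phi alpha theta -> T <= t ->
       Rabs (Re (Cexp (- (Ci * RtoC (omega0 * t)))
                 * R_d omega0 phi alpha heaviside rho theta t)%C
             - (- (b1 phi * z1 phi alpha theta * (2 * q phi + 1)
                   / (4 * PHI phi * omega0 ^ 2))
                * Rpower (rho / 2) (2 * q phi)
                * Rpower t (- (2 * q phi + 2))))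
       <= M * Rpower t (- (4 * q phi + 2)))
  /\
  (exists M T : R, 0 < T /\
     forall rho theta t : R,
       0 < rho <= rho0 -> in_Theta phi alpha theta -> T <= t ->
       Rabs (Im (Cexp (- (Ci * RtoC (omega0 * t)))
                 * R_d omega0 phi alpha heaviside rho theta t)%C
             - (- (b1 phi * z1 phi alpha theta / (4 * PHI phi * omega0))
                * Rpower (rho / 2) (2 * q phi)
                * Rpower t (- (2 * q phi + 1))))
       <= M * Rpower t (- (4 * q phi + 1))).
Proof.
  destruct (tail_integral_asymptotics omega0 phi alpha rho0 Homega0 Hphi Hrho0) as [M [T [HT HM]]].
  pose proof PI_RGT_0 as HPI.
  assert (HP : 0 < PHI phi) by (unfold PHI; lra).
  (* The threshold gives [t / rho > cosh 1] for every [rho <= rho0] at once, so that [B > 1]. *)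
  assert (Main : forall rho theta t, 0 < rho <= rho0 -> in_Theta phi alpha theta ->
    T + (rho0 * cosh 1 + 1) <= t -> exists Ic Is,
    (Cexp (- (Ci * RtoC (omega0 * t))) * R_d omega0 phi alpha heaviside rho theta t)%C
      = (- Ic / (4 * PHI phi), - Is / (4 * PHI phi)) /\
    Rabs (Ic - b1 phi * z1 phi alpha theta * (2 * q phi + 1) / omega0 ^ 2
            * (Rpower (rho / 2) (2 * q phi) * Rpower t (- (2 * q phi + 2))))
      <= M * Rpower t (- (4 * q phi + 2)) /\
    Rabs (Is - b1 phi * z1 phi alpha theta / omega0
            * (Rpower (rho / 2) (2 * q phi) * Rpower t (- (2 * q phi + 1))))
      <= M * Rpower t (- (4 * q phi + 1))).
  { intros rho theta t Hr Hth Ht; pose proof (cosh_ge_1 1).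
    destruct (arcosh_exists (t / rho)) as [B [HB EB]].
    { apply (Rlt_div_r (cosh 1) t rho); [lra|].
      pose proof (Rmult_le_compat_l (cosh 1) rho rho0 ltac:(lra) (proj2 Hr)); lra. }
    assert (Et : t = rho * cosh B) by (rewrite EB; field; lra).
    destruct (R_d_tail_integrals omega0 phi alpha rho theta t B Hphi
      (in_Theta_regular _ _ _ Hphi Halpha Hth) (proj1 Hr) ltac:(lra) Et) as [Ic [Is [LC [LS E]]]].
    exists Ic, Is; split; [exact E|].
    apply (HM rho theta t B); auto; nra. }
  pose proof (cosh_ge_1 1).
  split; exists (/ (4 * PHI phi) * M), (T + (rho0 * cosh 1 + 1)); (split; [nra|]);
    intros rho theta t Hr Hth Ht; destruct (Main rho theta t Hr Hth Ht) as [Ic [Is [-> [EC ES]]]];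
    simpl Re; simpl Im; rewrite (Rmult_assoc _ M).
  - replace (_ - _) with (- / (4 * PHI phi) *
      (Ic - b1 phi * z1 phi alpha theta * (2 * q phi + 1) / omega0 ^ 2
            * (Rpower (rho / 2) (2 * q phi) * Rpower t (- (2 * q phi + 2))))) by (field; lra).
    rewrite Rabs_mult, Rabs_Ropp, Rabs_pos_eq by (left; apply Rinv_0_lt_compat; lra).
    apply Rmult_le_compat_l; [left; apply Rinv_0_lt_compat; lra | exact EC].
  - replace (_ - _) with (- / (4 * PHI phi) *
      (Is - b1 phi * z1 phi alpha theta / omega0
            * (Rpower (rho / 2) (2 * q phi) * Rpower t (- (2 * q phi + 1))))) by (field; lra).
    rewrite Rabs_mult, Rabs_Ropp, Rabs_pos_eq by (left; apply Rinv_0_lt_compat; lra).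
    apply Rmult_le_compat_l; [left; apply Rinv_0_lt_compat; lra | exact ES].
Qed.
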